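(* Let $n\ge 3$, let $R$ be a commutative ring with $1$, let $A$ be a quasi-finite $R$-algebra with identity, and let $I_0,I_1,\dots,I_m$ ($m\ge 0$) be two-sided ideals of $A$. Then $$\big[E_n(A,I_0),\operatorname{GL}_n(A,I_1),\operatorname{GL}_n(A,I_2),\ldots,\operatorname{GL}_n(A,I_m)\big]=\big[E_n(A,I_0),E_n(A,I_1),E_n(A,I_2),\ldots,E_n(A,I_m)\big].$$
   Context: Rings are associative with $1$. An $R$-algebra $A$ is module finite over $R$ if it is finitely generated as an $R$-module; $A$ is quasi-finite over $R$ if there is a direct system of module finite $R$-subalgebras $A_i$ of $A$ with $\varinjlim A_i=A$. For $1\le i\ne j\le n$ and $a\in A$, $e_{i,j}(a)\in\operatorname{GL}_n(A)$ is the elementary matrix with $1$'s on the diagonal, $a$ in position $(i,j)$, and $0$ elsewhere. $E_n(A)$ is the subgroup of $\operatorname{GL}_n(A)$ generated by all $e_{i,j}(a)$, $a\in A$. For a two-sided ideal $I$ of $A$: $\operatorname{GL}_n(A,I)=\ker(\operatorname{GL}_n(A)\to\operatorname{GL}_n(A/I))$ is the congruence subgroup of level $I$; $E_n(I)$ is the subgroup generated by all $e_{i,j}(\alpha)$ with $\alpha\in I$, $i\ne j$; and $E_n(A,I)$ is the normal closure of $E_n(I)$ in $E_n(A)$. For group elements, $[x,y]=xyx^{-1}y^{-1}$; for subgroups $H,K$, $[H,K]$ is the subgroup generated by all $[h,k]$, $h\in H$, $k\in K$. Multiple commutators are left-normed: $[H_0,H_1,\dots,H_m]=[\dots[[H_0,H_1],H_2],\dots,H_m]$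 (for $m=0$ this is $H_0$). *)

(* Defs.v *)
From HB Require Import structures.
From mathcomp Require Import all_boot all_order all_algebra ring_quotient.
From mathcomp Require Import generic_quotient boolp classical_sets.

Set Implicit Arguments.
Unset Strict Implicit.
Unset Printing Implicit Defensive.

Import GRing.Theory.
Local Open Scope quotient_scope.
Local Open Scope classical_set_scope.
Local Open Scope ring_scope.

(* Rings are [pzRingType]s throughout: associative and unital, possibly zero
   and possibly non-commutative.  The zero ring is needed at least for A / I
   when I = A. *)

Section Groups.
Variable G : groupType.
Implicit Types (x y : G) (S H K N : set G).

Definition is_subgroup H : Prop :=
  [/\ H 1%g, forall x y, H x -> H y -> H (x * y)%g & forall x, H x -> H x^-1%g].

Definition subgroup_gen S : set G := smallest is_subgroup S.

(* The library's [~ x, y] is x^-1 * y^-1 * x * y, which is not the convention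
   used here. *)
Definition comm_elt x y : G := (x * y * x^-1 * y^-1)%g.

Definition comm_subgroup H K : set G :=
  subgroup_gen [set z | exists x y, [/\ H x, K y & z = comm_elt x y]].

(* multi_comm H0 [:: H1; ..; Hm] = [..[[H0, H1], H2], .., Hm] *)
Definition multi_comm H (Ks : seq (set G)) : set G := foldl comm_subgroup H Ks.

Definition normal_closure K S : set G :=
  subgroup_gen [set z | exists k s, [/\ K k, S s & z = (k * s * k^-1)%g]].

End Groups.

Section Units.
Variable S : pzRingType.

(* The library's unit groups require decidable invertibility or finiteness, so
   a unit is represented together with its (unique) inverse. *)
Record units := Units {
  units_pair : S * S;
  _ : (units_pair.1 * units_pair.2 == 1) && (units_pair.2 * units_pair.1 == 1)
}.

HB.instance Definition _ := [isSub for units_pair].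
HB.instance Definition _ := [Choice of units by <:].

Definition uval (u : units) : S := (units_pair u).1.
Definition uinv (u : units) : S := (units_pair u).2.

Lemma uvalK u : uval u * uinv u = 1.
Proof. by case: u => p up; have /andP[/eqP] := up. Qed.

Lemma uinvK u : uinv u * uval u = 1.
Proof. by case: u => p up; have /andP[_ /eqP] := up. Qed.

Lemma uval_inj : injective uval.
Proof.
move=> u v uv; apply: val_inj; rewrite /= [units_pair u]surjective_pairing.
rewrite [units_pair v]surjective_pairing -/(uval u) -/(uval v) -/(uinv u).
rewrite -/(uinv v) uv; congr (_, _).
by rewrite -[LHS]mulr1 -(uvalK v) mulrA -uv uinvK mul1r.
Qed.

Definition mk_unit (x y : S) (xy : x * y = 1) (yx : y * x = 1) : units :=
  @Units (x, y) (introT andP (conj (introT eqP xy) (introT eqP yx))).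

Definition unit_one : units := mk_unit (mul1r 1) (mul1r 1).
Definition unit_inv (u : units) : units := mk_unit (uinvK u) (uvalK u).

Lemma unit_mul_subproof u v : (uval u * uval v) * (uinv v * uinv u) = 1.
Proof. by rewrite mulrA -(mulrA (uval u)) uvalK mulr1 uvalK. Qed.

Lemma unit_mul_subproof' u v : (uinv v * uinv u) * (uval u * uval v) = 1.
Proof. by rewrite mulrA -(mulrA (uinv v)) uinvK mulr1 uinvK. Qed.

Definition unit_mul (u v : units) : units :=
  mk_unit (unit_mul_subproof u v) (unit_mul_subproof' u v).

Lemma unit_mulA : associative unit_mul.
Proof. by move=> u v w; apply: uval_inj; rewrite /uval /= mulrA. Qed.
Lemma unit_mul1 : left_id unit_one unit_mul.
Proof. by move=> u; apply: uval_inj; rewrite /uval /= mul1r. Qed.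
Lemma unit_1mul : right_id unit_one unit_mul.
Proof. by move=> u; apply: uval_inj; rewrite /uval /= mulr1. Qed.
Lemma unit_mulV : left_inverse unit_one unit_inv unit_mul.
Proof. by move=> u; apply: uval_inj; exact: uinvK. Qed.
Lemma unit_Vmul : right_inverse unit_one unit_inv unit_mul.
Proof. by move=> u; apply: uval_inj; exact: uvalK. Qed.

HB.instance Definition _ :=
  isGroup.Build units unit_mulA unit_mul1 unit_1mul unit_mulV unit_Vmul.

End Units.

Section UnitsMap.
Variables (S T : pzRingType) (f : {rmorphism S -> T}).

Lemma units_map_subproof (u : units S) : f (uval u) * f (uinv u) = 1.
Proof. by rewrite -rmorphM uvalK rmorph1. Qed.

Lemma units_map_subproof' (u : units S) : f (uinv u) * f (uval u) = 1.
Proof. by rewrite -rmorphM uinvK rmorph1. Qed.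

Definition units_map (u : units S) : units T :=
  mk_unit (units_map_subproof u) (units_map_subproof' u).

End UnitsMap.

Record ideal (A : pzRingType) := Ideal {
  ideal_set :> A -> Prop;
  ideal0 : ideal_set 0;
  idealB : forall x y, ideal_set x -> ideal_set y -> ideal_set (x - y);
  idealMl : forall a x, ideal_set x -> ideal_set (a * x);
  idealMr : forall a x, ideal_set x -> ideal_set (x * a)
}.

Section IdealQuotient.
Variables (A : pzRingType) (I : ideal A).

Definition ideal_pred : {pred A} := fun x => `[< I x >].

Lemma ideal_predP x : reflect (I x) (x \in ideal_pred).
Proof. exact: asboolP. Qed.

Lemma ideal_pred_zmod_closed : zmod_closed ideal_pred.
Proof.
split=> [|x y /ideal_predP Ix /ideal_predP Iy]; apply/ideal_predP.
  exact: ideal0.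
exact: idealB.
Qed.

HB.instance Definition _ :=
  GRing.isZmodClosed.Build A ideal_pred ideal_pred_zmod_closed.

(* The library's [ideal_quot] is a ring only for proper ideals of commutative
   rings, so the multiplication is put on its quotient of additive groups. *)
Definition quot_ring := Quotient.quot ideal_pred.
HB.instance Definition _ := GRing.Zmodule.on quot_ring.
HB.instance Definition _ := ZmodQuotient.on quot_ring.

Definition quot_proj (x : A) : quot_ring := \pi_quot_ring x.
Definition quot_one : quot_ring := quot_proj 1.
Definition quot_mul (x y : quot_ring) : quot_ring :=
  quot_proj (repr x * repr y).

Lemma quot_reprK (q : quot_ring) : quot_proj (repr q) = q.
Proof. exact: reprK. Qed.

Lemma quot_eqP (x y : A) : quot_proj x = quot_proj y <-> I (x - y).
Proof.
have -> : (quot_proj x = quot_proj y) <-> (quot_proj x == quot_proj y).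
  by split=> /eqP.
rewrite /quot_proj -Quotient.idealrBE; split=> /ideal_predP //.
Qed.

Lemma quot_projM (x y : A) :
  quot_proj (x * y) = quot_mul (quot_proj x) (quot_proj y).
Proof.
rewrite /quot_mul; apply/esym/quot_eqP.
set x' := repr _; set y' := repr _.
have Ix : I (x' - x) by apply/quot_eqP; rewrite quot_reprK.
have Iy : I (y' - y) by apply/quot_eqP; rewrite quot_reprK.
have -> : x' * y' - x * y = (x' - x) * y' - (0 - x * (y' - y)).
  by rewrite sub0r opprK mulrBl mulrBr addrA subrK.
apply: idealB; first exact: idealMr.
by apply: idealB; [exact: ideal0 | exact: idealMl].
Qed.

Lemma quot_projB (x y : A) : quot_proj (x - y) = quot_proj x - quot_proj y.
Proof. by rewrite /quot_proj !piE. Qed.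

Lemma quot_projD (x y : A) : quot_proj (x + y) = quot_proj x + quot_proj y.
Proof. by rewrite /quot_proj !piE. Qed.

Lemma quot_mulA : associative quot_mul.
Proof.
move=> x y z; rewrite -(quot_reprK x) -(quot_reprK y) -(quot_reprK z).
by rewrite -!quot_projM mulrA.
Qed.
Lemma quot_mul1 : left_id quot_one quot_mul.
Proof. by move=> x; rewrite -(quot_reprK x) -quot_projM mul1r. Qed.
Lemma quot_1mul : right_id quot_one quot_mul.
Proof. by move=> x; rewrite -(quot_reprK x) -quot_projM mulr1. Qed.
Lemma quot_mulDl : left_distributive quot_mul +%R.
Proof.
move=> x y z; rewrite -(quot_reprK x) -(quot_reprK y) -(quot_reprK z).
by rewrite -quot_projD -!quot_projM -quot_projD mulrDl.
Qed.
Lemma quot_mulDr : right_distributive quot_mul +%R.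
Proof.
move=> x y z; rewrite -(quot_reprK x) -(quot_reprK y) -(quot_reprK z).
by rewrite -quot_projD -!quot_projM -quot_projD mulrDr.
Qed.

HB.instance Definition _ := GRing.Zmodule_isPzRing.Build quot_ring
  quot_mulA quot_mul1 quot_1mul quot_mulDl quot_mulDr.

HB.instance Definition _ :=
  GRing.isZmodMorphism.Build A quot_ring quot_proj quot_projB.
HB.instance Definition _ :=
  GRing.isMonoidMorphism.Build A quot_ring quot_proj (erefl, quot_projM).

End IdealQuotient.

(* An R-algebra is a ring A with a ring morphism phi from R to its centre, r
   acting on A as multiplication by phi r; the library's [algType] would
   exclude the zero algebra. *)

Section Algebras.
Variables (R : comPzRingType) (A : pzRingType) (phi : {rmorphism R -> A}).

Definition central_morphism : Prop := forall r a, phi r * a = a * phi r.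

Definition is_subalgebra (B : set A) : Prop :=
  [/\ B 1, forall x y, B x -> B y -> B (x - y),
      forall x y, B x -> B y -> B (x * y) & forall r x, B x -> B (phi r * x)].

Definition module_finite (B : set A) : Prop :=
  exists (k : nat) (b : 'I_k -> A),
    (forall i, B (b i)) /\
    (forall x, B x -> exists r : 'I_k -> R, x = \sum_i phi (r i) * b i).

(* Since the transition maps are the inclusions between subalgebras of A, the
   canonical map from the direct limit to A is injective, and the limit is A
   exactly when the subalgebras cover A. *)
Definition quasi_finite : Prop :=
  exists (J : Type) (le : J -> J -> Prop) (B : J -> set A),
    [/\ inhabited J,
        (forall i, le i i) /\ (forall i j k, le i j -> le j k -> le i k),
        forall i j, exists k, le i k /\ le j k,
        forall i j, le i j -> B i `<=` B j &
        (forall i, is_subalgebra (B i) /\ module_finite (B i)) /\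
        \bigcup_(i in setT) B i = setT].

End Algebras.

Section GL.
Variables (n : nat) (A : pzRingType).

Definition GL := units 'M[A]_n.
HB.instance Definition _ := monoid.Group.on GL.

Definition elem_mx (i j : 'I_n) (a : A) : 'M[A]_n :=
  \matrix_(k, l) ((k == l)%:R + (if (k == i) && (l == j) then a else 0)).

Lemma elem_mxD (i j : 'I_n) (a b : A) :
  i != j -> elem_mx i j a * elem_mx i j b = elem_mx i j (a + b).
Proof.
move=> ij; apply/matrixP=> k l; rewrite !mxE.
under eq_bigr do rewrite !mxE mulrDl.
rewrite big_split /= (bigD1 k) //= eqxx mul1r big1 ?addr0; last first.
  by move=> m mk; rewrite eq_sym (negPf mk) mul0r.
rewrite (bigD1 j) //= big1 => [|m mj]; last first.
  by rewrite (negPf mj) andbF mul0r.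
rewrite addr0 eqxx andbT [j == i]eq_sym (negPf ij) /= addr0 -addrA.
congr (_ + _); case: (k == i); last by rewrite mul0r addr0.
rewrite /= [l == j]eq_sym; case: (j == l); last by rewrite mulr0 addr0.
by rewrite mulr1 addrC.
Qed.

Lemma elem_mx0 (i j : 'I_n) : elem_mx i j 0 = 1.
Proof. by apply/matrixP=> k l; rewrite !mxE if_same addr0. Qed.

Lemma elem_mxV (i j : 'I_n) (a : A) :
  i != j -> elem_mx i j a * elem_mx i j (- a) = 1.
Proof. by move=> ij; rewrite elem_mxD // subrr elem_mx0. Qed.

Lemma elem_mxV' (i j : 'I_n) (a : A) :
  i != j -> elem_mx i j (- a) * elem_mx i j a = 1.
Proof. by move=> ij; rewrite elem_mxD // addNr elem_mx0. Qed.

Definition elem (i j : 'I_n) (ij : i != j) (a : A) : GL :=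
  mk_unit (elem_mxV a ij) (elem_mxV' a ij).

(* The subgroup generated by the e_{i,j}(a) with a in X: it is E_n(A) for
   X = setT and E_n(I) for X = I. *)
Definition E (X : set A) : set GL :=
  subgroup_gen
    [set g | exists (i j : 'I_n) (ij : i != j) (a : A),
       X a /\ g = elem ij a].

Definition relE (I : ideal A) : set GL := normal_closure (E setT) (E (ideal_set I)).

Definition congGL (I : ideal A) : set GL :=
  [set g | units_map (map_mx (quot_proj I)) g = 1%g].

Lemma congGLP (I : ideal A) (g : GL) :
  congGL I g <-> forall i j, I (uval g i j - (1 : 'M[A]_n) i j).
Proof.
have -> : congGL I g <-> map_mx (quot_proj I) (uval g) = 1.
  by split=> [/(congr1 (@uval _))|gE] //; apply: uval_inj.
rewrite -(rmorph1 (map_mx (quot_proj I))); split=> [gE i j|gE].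
  by apply/quot_eqP; have /matrixP/(_ i j) := gE; rewrite !mxE.
by apply/matrixP=> i j; have /quot_eqP := gE i j; rewrite !mxE.
Qed.

End GL.

Arguments E n {A} X.
Arguments relE n {A} I.
Arguments congGL n {A} I.

(* Main.v *)
Require Import Defs.
From HB Require Import structures.
From mathcomp Require Import all_boot all_algebra generic_quotient boolp classical_sets.

(* Let Q = IJ + JI, and let m be a maximal ideal of R. A module finite algebra
   has stable range one modulo m, so an element g of GL(A, J), multiplied by a
   product of elements of E(J) in a single row, acquires a (p, p) entry dividing
   some central r outside m. For such g, the conjugate of e_pj(r a r) by g is an
   explicit product of elementary matrices, which differs from e_pj(r a r) by an
   element of any given subgroup D that is normalised by E(A) and contains E(Q)
   and all [e_kl(a), e_lk(b)] with a in I and b in J. Hence the s in R with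
   [e_pj(s a), g] in D for all multiples of s form an ideal contained in no
   maximal ideal. With D = [E(A, I), E(A, J)] this is the case m = 1:
   [E(A, I), GL(A, J)] = [E(A, I), E(A, J)].

   Since E(A, Q) <= [E(A, I), E(A, J)] <= GL(A, Q), the general case follows from
   [[E(A, I), E(A, J)], GL(A, K)] = [E(A, Q), E(A, K)] =: N by induction. By the
   same principle, applied to a D of elements commuting with GL(A, K) modulo N,
   it is enough to commute y = [e_ij(r a), e_ji(r b)] with a g in GL(A, K) whose
   (p, p) entry divides r, where p is different from i and j. Then g y g^-1
   equals, modulo N, the commutator obtained by conjugating only with the Schur
   complement of that entry; expanding it through the index p as a product of
   commutators [e_kp, e_pl] shows that modulo N it does not depend on g. *)

Module CongruenceCommutators.

Set Implicit Arguments.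
Unset Strict Implicit.
Unset Printing Implicit Defensive.

Import GRing.Theory Defs.
Local Open Scope classical_set_scope.
Local Open Scope ring_scope.

(** Nothing is localised at [m]. An entry that would become invertible is kept together with a [W]
    whose products with it in both orders are a central [r], and each formula with a denominator is
    replaced by a multiple without one: hence [r * a * r] instead of [a], [rho - C] instead of
    [1 - C / r], and [V * U] equal to [r] away from [p] instead of a matrix and its inverse. So no
    kernel of a localisation map has to be controlled.

    The obstacle is the commutators [[e_ij(a), e_ji(b)]]. Every other commutator of two elementary
    matrices is trivial or again elementary, so modulo [E(A, Q)] only these remain to be understood.
    This is why [D] is required to contain them, and why the triple commutators come down to them.

    Passing from [g] to [eps * g] must not disturb what is conjugated. In the first case [eps] sits
    in row [p] and commutes with [e_pj]; in the second it lies in [E(A, K)], and a three-subgroup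
    argument shows beforehand that this group commutes with [[E(A, I), E(A, J)]] modulo [N]. *)

Lemma subrBACA (V : zmodType) (x y u v : V) : x - y - (u - v) = x - u - (y - v).
Proof. by rewrite !opprB addrACA [RHS]addrACA [- y - u]addrC. Qed.

(** * Congruences modulo a two-sided ideal *)

Section IdealTheory.
Variables (A : pzRingType) (I : ideal A).

Lemma idealN x : I x -> I (- x).
Proof. by move=> Ix; rewrite -[- x]add0r; apply: idealB => //; apply: ideal0. Qed.

Lemma idealD x y : I x -> I y -> I (x + y).
Proof. by move=> Ix Iy; rewrite -[y]opprK; apply: idealB => //; apply: idealN. Qed.

Lemma ideal_sum (T : Type) (s : seq T) (P : pred T) (F : T -> A) :
  (forall i, P i -> I (F i)) -> I (\sum_(i <- s | P i) F i).
Proof. by move=> IF; elim/big_ind: _ => //; [apply: ideal0 | apply: idealD]. Qed.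

Lemma ideal_eqmodM x x' y y' : I (x - x') -> I (y - y') -> I (x * y - x' * y').
Proof.
move=> Ix Iy; have -> : x * y - x' * y' = (x - x') * y + x' * (y - y').
  by rewrite mulrBl mulrBr addrA subrK.
by apply: idealD; [apply: idealMr | apply: idealMl].
Qed.

Lemma ideal_eqmod_det n (M M' : 'M[A]_n) :
  (forall i j, I (M i j - M' i j)) -> I (\det M - \det M').
Proof.
move=> IM; rewrite -sumrB; apply: ideal_sum => s _.
rewrite -mulrBr; apply: idealMl.
elim/big_ind2: _ => [|x x' y y' ? ?|i _]; last exact: IM.
- by rewrite subrr; apply: ideal0.
- exact: ideal_eqmodM.
Qed.

End IdealTheory.

(** * Maximal ideals, with maximality stated as: the quotient is a field *)

Definition maximal_ideal (R : comPzRingType) (m : ideal R) : Prop :=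
  ~ m 1 /\ forall r, ~ m r -> exists s, m (1 - s * r).

Lemma maximal_ideal_prime (R : comPzRingType) (m : ideal R) r s :
  maximal_ideal m -> ~ m r -> ~ m s -> ~ m (r * s).
Proof.
case=> m1 mmax mr /mmax[t mt] mrs; apply: mr.
have -> : r = r * (1 - t * s) + t * (r * s).
  by rewrite mulrBr mulr1 mulrCA subrK.
by apply: idealD; [apply: idealMl | apply: idealMl].
Qed.

Section Zorn.
Variables (R : comPzRingType) (q : ideal R).

Lemma exists_maximal_ideal : ~ q 1 ->
  exists m : ideal R, maximal_ideal m /\ forall r, q r -> m r.
Proof.
move=> q1.
pose isid (X : set R) := [/\ forall x, q x -> X x,
  forall x y, X x -> X y -> X (x - y), forall a x, X x -> X (a * x) & ~ X 1].
(* The union of the empty chain is empty, so [P] has to admit [set0]; a maximal [M] differs from it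
   because [q] would be strictly larger. *)
pose P (X : set R) := X = set0 \/ isid X.
have [F FP Ftot|M [PM Mmax]] := @Zorn_bigcup R P.
  have [[X FX isX]|nF] := pselect (exists2 X, F X & isid X); last first.
    left; rewrite -subset0 => x [X FX Xx]; have [X0|isX] := FP X FX.
      by rewrite X0 in Xx.
    by case: nF; exists X.
  right; have FY Y y : F Y -> Y y -> isid Y.
    by move=> FY Yy; have [Y0|//] := FP Y FY; rewrite Y0 in Yy.
  split=> [x qx|x y [Y FY' Yx] [Z FZ Zy]|a x [Y FY' Yx]|[Y FY' Y1]].
  - by exists X => //; case: isX => + _ _ _; apply.
  - have [YZ|ZY] := Ftot _ _ FY' FZ.
      by exists Z => //; case: (FY Z y FZ Zy) => _ + _ _; apply => //; apply: YZ.
    by exists Y => //; case: (FY Y x FY' Yx) => _ + _ _; apply => //; apply: ZY.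
  - by exists Y => //; case: (FY Y x FY' Yx) => _ _ + _; apply.
  - by case: (FY Y 1 FY' Y1).
have isM : isid M.
  case: PM => // M0; exfalso; apply: (Mmax (q : set R)).
    by rewrite M0; split=> [? []|/(_ 0 (ideal0 q))].
  by right; split=> //; [apply: idealB | apply: idealMl].
case: isM => qM MB MM M1.
have M0 : M 0 by apply/qM/ideal0.
have MMr a x : M x -> M (x * a) by rewrite mulrC; apply: MM.
exists (Ideal M0 MB MM MMr); split=> //; split=> //= r Mr.
apply: contrapT => nex; pose M' := [set x | exists2 y, M y & exists s, x = y + s * r].
apply: (Mmax M'); last first.
  right; split=> [x qx|x y [x' Mx' [s ->]] [y' My' [t ->]]|a x [y My [s ->]]|].
  - by exists x; [apply: qM | exists 0; rewrite mul0r addr0].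
  - exists (x' - y'); first exact: MB.
    by exists (s - t); rewrite mulrBl opprD addrACA.
  - exists (a * y); first exact: MM.
    by exists (a * s); rewrite mulrDr mulrA.
  - case=> y My [s e]; apply: nex; exists s => /=.
    by rewrite e addrK.
split=> [x Mx|M'M]; first by exists x => //; exists 0; rewrite mul0r addr0.
by apply/Mr/M'M; exists 0 => //; exists 1; rewrite mul1r add0r.
Qed.

End Zorn.

(** * Module finite algebras: Nakayama's lemma at a maximal ideal *)

Section ModuleFinite.
Variables (R : comPzRingType) (A : pzRingType) (phi : {rmorphism R -> A}).
Hypothesis phiC : central_morphism phi.
Variables (k : nat) (b : 'I_k -> A).
Hypothesis b_span : forall x, exists r : 'I_k -> R, x = \sum_i phi (r i) * b i.

Section Ext.
Variable m : ideal R.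

(** The extension [m A]: as the [b i] span [A], combinations of them with coefficients in [m] reach
    every [phi r * x] with [m r]. *)
Definition ext_set : set A :=
  [set x | exists r : 'I_k -> R, (forall i, m (r i)) /\ x = \sum_i phi (r i) * b i].

Lemma ext_set0 : ext_set 0.
Proof.
exists (fun=> 0); split=> [i|]; first exact: ideal0.
by rewrite big1 // => i _; rewrite rmorph0 mul0r.
Qed.

Lemma ext_setB x y : ext_set x -> ext_set y -> ext_set (x - y).
Proof.
move=> [r [mr ->]] [s [ms ->]]; exists (fun i => r i - s i); split=> [i|].
  exact: idealB.
by rewrite -sumrB; apply: eq_bigr => i _; rewrite rmorphB mulrBl.
Qed.

Lemma ext_setD x y : ext_set x -> ext_set y -> ext_set (x + y).
Proof.
move=> [r [mr ->]] [s [ms ->]]; exists (fun i => r i + s i); split=> [i|].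
  exact: idealD.
by rewrite -big_split; apply: eq_bigr => i _; rewrite rmorphD mulrDl.
Qed.

Lemma ext_set_phi r x : m r -> ext_set (phi r * x).
Proof.
have [s ->] := b_span x => mr; exists (fun i => r * s i); split=> [i|].
  exact: idealMr.
by rewrite mulr_sumr; apply: eq_bigr => i _; rewrite rmorphM mulrA.
Qed.

Lemma ext_setMl a x : ext_set x -> ext_set (a * x).
Proof.
move=> [r [mr ->]]; rewrite mulr_sumr.
elim/big_ind: _ => [|? ?|i _]; [exact: ext_set0 | exact: ext_setD |].
by rewrite mulrA -phiC -mulrA; apply: ext_set_phi.
Qed.

Lemma ext_setMr a x : ext_set x -> ext_set (x * a).
Proof.
move=> [r [mr ->]]; rewrite mulr_suml.
elim/big_ind: _ => [|? ?|i _]; [exact: ext_set0 | exact: ext_setD |].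
by rewrite -mulrA; apply: ext_set_phi.
Qed.

Definition ext_ideal : ideal A :=
  Ideal ext_set0 ext_setB ext_setMl ext_setMr.

End Ext.

(** Determinant trick: each [b i] is in [N] up to a combination of the [b j] with coefficients in
    [m], so the matrix [M = 1 - mu] carries the tuple [b] into [N]. Multiplying by the adjugate,
    [\det M] carries every [b i] into [N], and it is 1 modulo [m]. [N] is merely an [R]-submodule,
    so that left and right ideals are both covered. *)
Lemma nakayama (m : ideal R) (N : set A) :
  maximal_ideal m -> N 0 -> (forall x y, N x -> N y -> N (x + y)) ->
  (forall r x, N x -> N (phi r * x)) ->
  (forall i, exists2 y, N y & ext_ideal m (b i - y)) ->
  exists2 r, ~ m r & N (phi r).
Proof.
move=> mmax N0 ND NZ bN.
have /choice[mu muP] : forall i, exists mu : 'I_k -> R,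
    (forall j, m (mu j)) /\ N (b i - \sum_j phi (mu j) * b j).
  by move=> i; have [y Ny [mu [mmu e]]] := bN i; exists mu; split=> //;
    rewrite -e opprB addrC subrK.
pose M := 1%:M - \matrix_(i, j) mu i j.
exists (\det M).
  case: mmax => m1 _ mdet; apply: m1.
  have := @ideal_eqmod_det _ m _ M 1%:M.
  rewrite det1 => /(_ _)/(idealB mdet); rewrite opprB addrC subrK; apply=> i j.
  by rewrite !mxE addrAC subrr sub0r; apply: idealN; case: (muP i).
have NM i : N (\sum_j phi (M i j) * b j).
  have [_] := muP i; congr N; rewrite (bigD1 i) //= [in RHS](bigD1 i) //=.
  rewrite !mxE eqxx rmorphB rmorph1 mulrBl mul1r opprD addrA; congr (_ + _).
  rewrite -sumrN; apply: eq_bigr => j ji.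
  by rewrite !mxE eq_sym (negPf ji) sub0r rmorphN mulNr.
have Nsum (s : 'I_k -> R) (F : 'I_k -> A) :
    (forall i, N (F i)) -> N (\sum_i phi (s i) * F i).
  by move=> NF; elim/big_ind: _ => // i _; apply: NZ.
have Ndetb i : N (phi (\det M) * b i).
  have := Nsum (fun j => (\adj M) i j) _ NM; congr N.
  under eq_bigr do rewrite mulr_sumr.
  rewrite exchange_big /= (bigD1 i) //= [X in _ + X]big1 ?addr0 => [|j ji].
    under eq_bigr do rewrite mulrA -rmorphM.
    rewrite -mulr_suml -rmorph_sum; congr (phi _ * _).
    by have /matrixP/(_ i i) := mul_adj_mx M; rewrite !mxE eqxx mulr1n.
  under eq_bigr do rewrite mulrA -rmorphM.
  rewrite -mulr_suml -rmorph_sum.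
  have /matrixP/(_ i j) := mul_adj_mx M.
  by rewrite !mxE eq_sym (negPf ji) mulr0n => ->; rewrite rmorph0 mul0r.
have [s s1] := b_span 1.
rewrite -[phi _]mulr1 s1 mulr_sumr.
have := Nsum s _ Ndetb; congr N; apply: eq_bigr => i _.
by rewrite !mulrA (phiC (s i)).
Qed.

(** * Left ideals modulo [m A]: chain conditions, radical, stable range one *)

Section LeftIdeals.
Variable m : ideal R.
Hypothesis mmax : maximal_ideal m.
Local Notation mA := (ext_ideal m).

(** Left ideals containing [m A] stand for the left ideals of [A / m A], an algebra of finite
    dimension over the field [R / m]. *)
Definition lideal (L : set A) : Prop :=
  [/\ forall x, mA x -> L x, forall x y, L x -> L y -> L (x - y)
    & forall a x, L x -> L (a * x)].

Section LidealTheory.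
Variable L : set A.
Hypothesis lL : lideal L.

Lemma lideal_ext x : mA x -> L x. Proof. by case: lL => + _ _; apply. Qed.
Lemma lidealB x y : L x -> L y -> L (x - y). Proof. by case: lL => _ + _; apply. Qed.
Lemma lidealM a x : L x -> L (a * x). Proof. by case: lL => _ _; apply. Qed.
Lemma lideal0 : L 0. Proof. exact/lideal_ext/ideal0. Qed.
Lemma lidealD x y : L x -> L y -> L (x + y).
Proof.
by move=> Lx Ly; rewrite -[y]opprK -[- y]sub0r; apply: lidealB => //;
  apply: lidealB => //; apply: lideal0.
Qed.

End LidealTheory.

Lemma lideal_extE : lideal mA.
Proof. by split=> //; [apply: idealB | apply: idealMl]. Qed.

(* Indices of the leading basis elements of L, after normalising the leading
   coefficient modulo m: the strictly monotone rank behind both chain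
   conditions. *)
Definition lead (L : set A) : {set 'I_k} :=
  [set i | `[< exists r : 'I_k -> R, L (b i + \sum_(j < k | (j < i)%N) phi (r j) * b j) >]].

Lemma leadP L i : reflect
  (exists r : 'I_k -> R, L (b i + \sum_(j < k | (j < i)%N) phi (r j) * b j))
  (i \in lead L).
Proof. by rewrite finset.in_set; apply: asboolP. Qed.

Lemma lead_sub L L' : L `<=` L' -> lead L \subset lead L'.
Proof.
move=> LL'; apply/fintype.subsetP => i /leadP[r Lr].
by apply/leadP; exists r; apply: LL'.
Qed.

(** Gaussian elimination. A top coefficient in [m] gives a term in [m A], hence in [L]. Otherwise
    the top index is in [lead L'], so in [lead L], and subtracting a multiple of an element of [L]
    with that leading index lowers the top index. *)
Lemma lead_eq L L' : lideal L -> lideal L' -> L `<=` L' ->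
  lead L' \subset lead L -> L' `<=` L.
Proof.
move=> lL lL' LL' leadL.
suff H t : (t <= k)%N -> forall r : 'I_k -> R,
    L' (\sum_(j < k | (j < t)%N) phi (r j) * b j) ->
    L (\sum_(j < k | (j < t)%N) phi (r j) * b j).
  move=> x; have [r ->] := b_span x => L'x.
  have e : \sum_i phi (r i) * b i = \sum_(i < k | (i < k)%N) phi (r i) * b i.
    by apply: eq_bigl => i; rewrite ltn_ord.
  by rewrite e; apply: H => //; rewrite -e.
elim: t => [_ r _|t IH tk r].
  by rewrite big_pred0 //; apply: lideal0.
have split s : \sum_(j < k | (j < t.+1)%N) phi (s j) * b j =
    phi (s (Ordinal tk)) * b (Ordinal tk) + \sum_(j < k | (j < t)%N) phi (s j) * b j.
  rewrite (bigD1 (Ordinal tk)) //=; congr (_ + _); apply: eq_bigl => j.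
  by rewrite ltnS -val_eqE /= andbC -ltn_neqAle.
rewrite split; set i := Ordinal tk => L'r.
have [mr|mr] := pselect (m (r i)).
  have mAr : mA (phi (r i) * b i) by apply: ext_set_phi.
  apply: lidealD => //; first exact: lideal_ext.
  apply: IH; first exact: ltnW.
  by rewrite -[X in L' X](addKr (phi (r i) * b i)) addrC;
    apply: lidealB => //; apply: lideal_ext.
have [_ /(_ _ mr)[s ms]] := mmax.
have : i \in lead L'.
  apply/leadP; exists (fun j => s * r j).
  have -> : b i + \sum_(j < k | (j < i)%N) phi (s * r j) * b j
    = phi (1 - s * r i) * b i + phi s * (phi (r i) * b i + \sum_(j < k | (j < t)%N) phi (r j) * b j).
    rewrite mulrDr mulrA -rmorphM addrA -mulrDl -rmorphD subrK rmorph1 mul1r.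
    congr (_ + _); rewrite mulr_sumr; apply: eq_bigr => j _.
    by rewrite mulrA -rmorphM.
  apply: lidealD => //; first by apply: lideal_ext => //; apply: ext_set_phi.
  exact: lidealM.
move/(fintype.subsetP leadL)/leadP=> [u Lu].
have e : phi (r i) * b i + \sum_(j < k | (j < t)%N) phi (r j) * b j =
   phi (r i) * (b i + \sum_(j < k | (j < i)%N) phi (u j) * b j) +
   \sum_(j < k | (j < t)%N) phi (r j - r i * u j) * b j.
  rewrite mulrDr -addrA; congr (_ + _); rewrite mulr_sumr -big_split.
  by apply: eq_bigr => j _ /=; rewrite mulrA -rmorphM -mulrDl -rmorphD addrC subrK.
rewrite e in L'r *.
have Lru := lidealM lL (phi (r i)) Lu.
apply: lidealD => //; apply: IH; first exact: ltnW.
move: (lidealB lL' L'r (LL' _ Lru)).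
by rewrite addrC addrA addNr add0r.
Qed.

Lemma lideal_max (P : set A -> Prop) L0 : P L0 -> (forall L, P L -> lideal L) ->
  exists L, P L /\ forall L', P L' -> L `<=` L' -> L' `<=` L.
Proof.
move=> PL0 Pl.
have [d] := ubnP (k - #|lead L0|); elim: d L0 PL0 => // d IH L0 PL0 dL.
have [//|nmax] := pselect (exists L, P L /\ forall L', P L' -> L `<=` L' -> L' `<=` L).
have [L' [PL' LL' nL'L]] : exists L', [/\ P L', L0 `<=` L' & ~ L' `<=` L0].
  apply: contrapT => nex; apply: nmax; exists L0; split=> // L' PL' LL'.
  by apply: contrapT => nL; apply: nex; exists L'.
apply: (IH L') => //.
have lt : (#|lead L0| < #|lead L'|)%N.
  apply: proper_card; rewrite fintype.properE lead_sub //=.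
  by apply/negP => /(lead_eq (Pl _ PL0) (Pl _ PL') LL').
have := max_card (lead L'); rewrite card_ord => le.
by rewrite -ltnS; apply: leq_trans dL; rewrite ltnS ltn_sub2l // (leq_trans lt).
Qed.

Lemma lideal_min (P : set A -> Prop) L0 : P L0 -> (forall L, P L -> lideal L) ->
  exists L, P L /\ forall L', P L' -> L' `<=` L -> L `<=` L'.
Proof.
move=> PL0 Pl.
have [d] := ubnP #|lead L0|; elim: d L0 PL0 => // d IH L0 PL0 dL.
have [//|nmin] := pselect (exists L, P L /\ forall L', P L' -> L' `<=` L -> L `<=` L').
have [L' [PL' LL' nL'L]] : exists L', [/\ P L', L' `<=` L0 & ~ L0 `<=` L'].
  apply: contrapT => nex; apply: nmin; exists L0; split=> // L' PL' LL'.
  by apply: contrapT => nL; apply: nex; exists L'.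
apply: (IH L') => //; rewrite -ltnS; apply: leq_trans dL.
rewrite ltnS proper_card //.
rewrite fintype.properE lead_sub //=.
by apply/negP => /(lead_eq (Pl _ PL') (Pl _ PL0) LL').
Qed.

(* A surjective endomorphism of the Noetherian module T / U is injective. *)
Lemma surj_inj (U T : set A) x : lideal U -> lideal T ->
  (forall t, U t -> U (t * x)) -> (forall t, T t -> T (t * x)) ->
  (forall t, T t -> exists2 s, T s & U (t - s * x)) ->
  forall t, T t -> U (t * x) -> U t.
Proof.
move=> lU lT Ux Tx surj.
(* Kernels of the powers of [x] on [T / U]. The chain stops at some [n]; writing [t] as [s * x ^+ n]
   modulo [U], the assumption on [t * x] puts [s] in the next kernel, hence in [K n]. *)
pose K n := [set t | T t /\ U (t * x ^+ n)].
have [||_ [[n ->] Kmax]] := @lideal_max (fun L => exists n, L = K n) (K 0).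
- by exists 0%N.
- move=> _ [n ->]; split=> [y my|y z [Ty Uy] [Tz Uz]|a y [Ty Uy]].
  + by split; apply: lideal_ext => //; apply: idealMr.
  + by split; [apply: lidealB | rewrite mulrBl; apply: lidealB].
  + by split; [apply: lidealM | rewrite -mulrA; apply: lidealM].
have surjn j t : T t -> exists2 s, T s & U (t - s * x ^+ j).
  elim: j t => [t Tt|j IH t Tt].
    by exists t => //; rewrite expr0 mulr1 subrr; apply: lideal0.
  have [s Ts Us] := IH t Tt; have [s' Ts' Us'] := surj s Ts.
  exists s' => //.
  have -> : t - s' * x ^+ j.+1 = (t - s * x ^+ j) + (s - s' * x) * x ^+ j.
    by rewrite exprS mulrBl mulrA addrA subrK.
  apply: lidealD => //.
  by elim: j {IH Us} => [|j IHj]; rewrite ?mulr1 // exprSr mulrA; apply: Ux.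
move=> t Tt Utx; have [s Ts Us] := surjn n t Tt.
rewrite -[t](subrK (s * x ^+ n)); apply: lidealD => //.
suff [] : K n s by [].
apply: (Kmax (K n.+1)); first by exists n.+1.
  by move=> y [Ty Uy]; split=> //; rewrite exprSr mulrA; apply: Ux.
split=> //; rewrite exprSr mulrA.
rewrite -[X in U X](subKr (t * x)); apply: lidealB => //.
by rewrite -mulrBl; apply: Ux.
Qed.

Definition lideal_add (U : set A) (x : A) : set A := [set z | exists s, U (z - s * x)].

Lemma lideal_addP U x : lideal U -> lideal (lideal_add U x).
Proof.
move=> lU; split=> [z mz|y z [s Us] [t Ut]|a z [s Us]].
- by exists 0; rewrite mul0r subr0; apply: (lideal_ext lU).
- exists (s - t); have -> : y - z - (s - t) * x = (y - s * x) - (z - t * x).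
    by rewrite mulrBl subrBACA.
  exact: lidealB.
- by exists (a * s); rewrite -mulrA -mulrBr; apply: lidealM.
Qed.

Lemma sub_lideal_add (U : set A) x : U `<=` lideal_add U x.
Proof. by move=> z Uz; exists 0; rewrite mul0r subr0. Qed.

Lemma lideal_add_id U x : lideal U -> lideal_add U x x.
Proof. by move=> lU; exists 1; rewrite mul1r subrr; apply: lideal0. Qed.

Definition max_lideal (M : set A) : Prop :=
  [/\ lideal M, ~ M 1 & forall L, lideal L -> M `<=` L -> ~ L 1 -> L `<=` M].

Lemma sub_max_lideal L : lideal L -> ~ L 1 -> exists2 M, max_lideal M & L `<=` M.
Proof.
move=> lL L1.
have [||M [[lM M1 LM] Mmax]] :=
  @lideal_max (fun L' => [/\ lideal L', ~ L' 1 & L `<=` L']) L.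
- by split.
- by move=> L' [].
exists M => //; split=> // L' lL' ML' L'1; apply: Mmax => //; split=> //.
exact: subset_trans LM ML'.
Qed.

(** The preimage in [A] of the Jacobson radical of [A / m A], since each [max_lideal] contains
    [m A]. *)
Definition jac : set A := [set x | forall M, max_lideal M -> M x].

Lemma lideal_jac : lideal jac.
Proof.
split=> [x mx M [lM _ _]|x y jx jy M mM|a x jx M mM].
- exact: lideal_ext.
- by have [lM _ _] := mM; apply: lidealB; [|apply: jx|apply: jy].
- by have [lM _ _] := mM; apply: lidealM; [|apply: jx].
Qed.

(** If [x] is not in [M], then [C] is the kernel of the map [s |-> s * x] from [A] onto the simple
    module [A / M], hence again a maximal left ideal, and [y] lies in it. *)
Lemma jacMr x y : jac y -> jac (y * x).
Proof.
move=> jy M mM; have [lM M1 Mmax] := mM.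
have [Mx|Mx] := pselect (M x); first exact: lidealM.
pose C := [set s | M (s * x)].
suff mC : max_lideal C by have := jy C mC.
split=> [||L lL CL L1 s Ls].
- split=> [z mz|z t Mz Mt|a z Mz]; rewrite /C /=.
  + by apply: lideal_ext => //; apply: idealMr.
  + by rewrite mulrBl; apply: lidealB.
  + by rewrite -mulrA; apply: lidealM.
- by rewrite /C /= mul1r.
apply: contrapT => Msx.
have [d Md] : lideal_add M (s * x) 1.
  apply: contrapT => nM'; apply: Msx; rewrite /C /=.
  apply: (Mmax (lideal_add M (s * x))) => //; first exact: lideal_addP.
    exact: sub_lideal_add.
  exact: lideal_add_id.
apply: L1.
have -> : 1 = (1 - x * d * s) + x * d * s by rewrite subrK.
apply: lidealD => //; last exact: lidealM.
apply: CL; rewrite /C /= mulrBl mul1r.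
have -> : x - x * d * s * x = x * (1 - d * (s * x)) by rewrite mulrBr mulr1 !mulrA.
exact: lidealM.
Qed.

(* A modulo its radical is semisimple. *)
Lemma complement K : lideal K -> exists2 e, K e & forall s, K s -> jac (s - s * e).
Proof.
(* [P L] says that [K + L = A], witnessed by [1 = e + (1 - e)]. A minimal such [L] meets [K] inside
   the radical only. *)
move=> lK; pose P L := lideal L /\ exists2 e, K e & L (1 - e).
have [||K' [[lK' [e Ke K'e]] K'min]] := @lideal_min P setT.
- by split=> //; exists 0 => //; apply: lideal0.
- by move=> L [].
exists e => // s Ks; have K'se : K' (s - s * e).
  by rewrite -[X in X - _]mulr1 -mulrBr; apply: lidealM.
have Kse : K (s - s * e) by apply: lidealB => //; apply: lidealM.
move=> M [lM M1 Mmax]; apply: contrapT => Mse.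
suff /(_ (s - s * e)) : K' `<=` K' `&` M by move=> /(_ K'se)[].
apply: K'min; last by move=> ? [].
have [d Md] : lideal_add M (s - s * e) 1.
  apply: contrapT => nM'; apply: Mse.
  apply: (Mmax (lideal_add M (s - s * e))) => //; first exact: lideal_addP.
    exact: sub_lideal_add.
  exact: lideal_add_id.
split.
  split=> [z mz|z u [? ?] [? ?]|a z [? ?]].
  - by split; apply: lideal_ext.
  - by split; apply: lidealB.
  - by split; apply: lidealM.
(* If [M] misses [s - s * e], correcting [e] by [z], which lies in both [K] and [K'], moves the
   complementary part [1 - (e + z)] into [M] as well, against minimality. *)
pose z := (1 - e) * (d * (s - s * e)).
exists (e + z); first by apply: lidealD => //; do 2!apply: lidealM => //.
have zE : 1 - (e + z) = (1 - e) * (1 - d * (s - s * e)).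
  by rewrite opprD addrA [RHS]mulrBr mulr1.
split; last by rewrite zE; apply: lidealM.
by rewrite opprD addrA; apply: lidealB => //; do 2!apply: lidealM => //.
Qed.

(* Stable range one: take d with A * x as large as possible modulo jac. If it is
   proper, right multiplication by x kills an idempotent e modulo jac, and some
   e * c * w lies outside A * x, so adding it to x enlarges A * x. *)
Lemma unimodular_unit_ext (X V : A) : exists d w, mA (1 - w * (X + d * (1 - V * X))).
Proof.
pose Ld d := lideal_add jac (X + d * (1 - V * X)).
have lLd d : lideal (Ld d) by apply/lideal_addP/lideal_jac.
have [||_ [[d ->] dmax]] := @lideal_max (fun L => exists d, L = Ld d) (Ld 0).
- by exists 0.
- by move=> _ [d ->].
exists d; move: dmax; rewrite /Ld; set x := X + d * _; set w := 1 - V * X => dmax.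
have lj := lideal_jac; have jMr := jacMr.
have [v [v' vx]] : exists v v', 1 = v * x + v' * w.
  exists V, (1 - V * d); rewrite mulrBl mul1r /x mulrDr mulrA /w.
  by rewrite addrACA subrr addr0 addrC subrK.
suff L1 : lideal_add jac x 1.
  apply: contrapT => ns; have [||M mM LM] := @sub_max_lideal (lideal_add mA x).
  - exact/lideal_addP/lideal_extE.
  - by move=> [s js]; apply: ns; exists s.
  have [lM M1 _] := mM; case: L1 => s js; apply: M1.
  rewrite -(subrK (s * x) 1); apply: lidealD => //; first exact: (js M mM).
  by apply: lidealM => //; apply: LM; apply: lideal_add_id; apply: lideal_extE.
apply: contrapT => L1.
pose K := [set s | jac (s * x)].
have lK : lideal K.
  split=> [s ms|s t Ks Kt|a s Ks]; rewrite /K /=.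
  - by apply: (lideal_ext lj); apply: idealMr.
  - by rewrite mulrBl; apply: (lidealB lj).
  - by rewrite -mulrA; apply: (lidealM lj).
have [e Ke eK] := complement lK.
(* Otherwise right multiplication by [x] is injective modulo [jac]. The descending chain of the left
   ideals generated by [x ^+ n] modulo [jac] stops, and cancelling [x ^+ n] puts 1 in [A * x] modulo
   [jac]. *)
have ejac : ~ jac e.
  move=> je; apply: L1.
  have Kjac s : K s -> jac s.
    by move=> Ks; rewrite -[s](subrK (s * e)); apply: (lidealD lj);
      [apply: eK | apply: (lidealM lj)].
  have Kjacn n s : jac (s * x ^+ n) -> jac s.
    elim: n s => [|n IH] s; first by rewrite mulr1.
    by rewrite exprS mulrA => /IH; apply: Kjac.
  have [||_ [[n ->] nmin]] :=
    @lideal_min (fun L => exists n, L = lideal_add jac (x ^+ n)) (lideal_add jac 1).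
  - by exists 0%N.
  - by move=> _ [n ->]; apply: lideal_addP.
  have [|z [s Us]||s js] := nmin (lideal_add jac (x ^+ n.+1)) _ _ (x ^+ n) _.
  - by exists n.+1.
  - by exists (s * x); rewrite -mulrA -exprS.
  - exact: lideal_add_id.
  exists s; apply: (Kjacn n); rewrite mulrBl mul1r -mulrA -exprS //.
have [c nLc] : exists c, ~ lideal_add jac x (e * c * w).
  apply: contrapT => nc; apply: ejac.
  have Lec c : lideal_add jac x (e * c * w).
    by apply: contrapT => nL; apply: nc; exists c.
  have lL := lideal_addP x lj.
  have Le c : lideal_add jac x (e * c).
    rewrite -[e * c]mulr1 vx mulrDr; apply: (lidealD lL).
      by rewrite mulrA; apply/(lidealM lL)/lideal_add_id.
    by rewrite mulrA -(mulrA e); apply: Lec.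
  (* [T] is the two-sided ideal generated by [e] and [jac]. Since all [e * c] are multiples of [x]
     modulo [jac], right multiplication by [x] is surjective on [T / jac], hence injective, although
     it kills [e]. *)
  pose T := [set t | forall U, lideal U -> (forall u a, U u -> U (u * a)) ->
    jac `<=` U -> U e -> U t].
  have lT : lideal T.
    split=> [t mt U lU|t u Tt Tu U lU UMr jU Ue|a t Tt U lU UMr jU Ue].
    - by move=> *; apply: lideal_ext.
    - by apply: (lidealB lU); [apply: Tt | apply: Tu].
    - by apply: (lidealM lU); apply: Tt.
  have TMr t a : T t -> T (t * a)
    by move=> Tt U lU UMr jU Ue; exact: (UMr _ _ (Tt U lU UMr jU Ue)).
  have Te : T e by move=> U.
  have jT : jac `<=` T by move=> t jt U _ _ jU _; exact: jU.
  refine (@surj_inj jac T x lj lT _ _ _ e Te Ke) => [t|t|t Tt];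
    [exact: jMr | exact: TMr |].
  suff Us : forall a, exists2 s, T s & jac (t * a - s * x).
    by have := Us 1; rewrite mulr1.
  apply: (Tt (fun t => forall a, exists2 s, T s & jac (t * a - s * x))).
  - split=> [z mz|y z Uy Uz|c z Uz] a.
    + exists 0; first exact: (lideal0 lT).
      rewrite mul0r subr0; apply: (lideal_ext lj); exact: idealMr.
    + have [[s Ts js] [u Tu ju]] := (Uy a, Uz a).
      exists (s - u); first exact: (lidealB lT).
      have -> : (y - z) * a - (s - u) * x = (y * a - s * x) - (z * a - u * x).
        by rewrite !mulrBl subrBACA.
      exact: (lidealB lj).
    + have [s Ts js] := Uz a; exists (c * s); first exact: (lidealM lT).
      by rewrite -!mulrA -mulrBr; apply: (lidealM lj).
  - by move=> u a Uu a'; rewrite -mulrA.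
  - move=> u ju a; exists 0; first exact: (lideal0 lT).
    by rewrite mul0r subr0; apply: jMr.
  - move=> a; have [d' jd'] := Le a; exists (e * d'); first exact: TMr.
    have -> : e * a - e * d' * x = (e - e * e) * a + e * (e * a - d' * x).
      by rewrite mulrBl mulrBr !mulrA addrA subrK.
    by apply: (lidealD lj); [exact: (jMr _ _ (eK e Ke)) | apply: (lidealM lj)].
have lL' := lideal_addP (X + (d + e * c) * w) lj.
have x'E : X + (d + e * c) * w = x + e * c * w by rewrite mulrDl addrA.
(* Modulo [jac], [e * x] is 0 and [e] is idempotent, so [e] times the new element is [e * c * w].
   Its left ideal therefore contains both [e * c * w] and [x]. *)
have Lecw : lideal_add jac (X + (d + e * c) * w) (e * c * w).
  exists e; rewrite x'E [e * (x + _)]mulrDr opprD addrA addrAC.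
  have -> : e * c * w - e * (e * c * w) = (e - e * e) * (c * w).
    by rewrite mulrBl !mulrA.
  by apply: (lidealB lj) => //; exact: (jMr _ _ (eK e Ke)).
apply: nLc; apply: (dmax _ _ _ _ Lecw); first by exists (d + e * c).
move=> z [s jz]; have -> : z = (z - s * x) + s * x by rewrite subrK.
apply: (lidealD lL'); first exact: sub_lideal_add.
apply: (lidealM lL'); rewrite -[x](addrK (e * c * w)) -x'E.
by apply: (lidealB lL' _ Lecw); exact: (lideal_add_id _ lj).
Qed.

(** Modulo [m A] a left inverse is two-sided, because a surjective endomorphism is injective.
    Nakayama's lemma then finds elements [phi r] in [A * x] and [phi r'] in [x * A] with [r] and
    [r'] outside [m]; the product [r * r'] serves both sides with one [W]. *)
Lemma unimodular_unit (X V : A) :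
  exists d W r, [/\ ~ m r, (X + d * (1 - V * X)) * W = phi r
                 & W * (X + d * (1 - V * X)) = phi r].
Proof.
have [d [w mw]] := unimodular_unit_ext X V; exists d; set x := X + _ in mw *.
have mw' : mA (1 - x * w).
  apply: (@surj_inj mA setT x) => //; first exact: lideal_extE.
  - by move=> t; apply: idealMr.
  - by move=> t _; exists (t * w) => //; rewrite -{1}[t]mulr1 -mulrA -mulrBr; apply: idealMl.
  - have -> : (1 - x * w) * x = x * (1 - w * x).
      by rewrite mulrBl mulrBr mul1r mulr1 mulrA.
    exact: idealMl.
have [|y z [s ->] [t ->]|r y [s ->]|i|r mr [s rE]] :=
  @nakayama m [set z | exists s, z = s * x] mmax.
- by exists 0; rewrite mul0r.
- by exists (s + t); rewrite mulrDl.
- by exists (phi r * s); rewrite mulrA.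
- exists (b i * w * x); first by exists (b i * w).
  by rewrite -{1}[b i]mulr1 -mulrA -mulrBr; apply: idealMl.
have [|y z [s' ->] [t ->]|r' y [s' ->]|i|r' mr' [t r'E]] :=
  @nakayama m [set z | exists s, z = x * s] mmax.
- by exists 0; rewrite mulr0.
- by exists (s' + t); rewrite mulrDr.
- by exists (phi r' * s'); rewrite mulrA phiC -mulrA phiC.
- exists (x * (w * b i)); first by exists (w * b i).
  by rewrite mulrA -{1}[b i]mul1r -mulrBl; apply: idealMr.
exists (phi r * t), (r * r'); split.
- exact: maximal_ideal_prime.
- by rewrite mulrA -phiC -mulrA -r'E rmorphM.
- have -> : phi r * t = phi r' * s by rewrite rE -mulrA -r'E phiC.
  by rewrite -mulrA -rE -rmorphM mulrC.
Qed.

End LeftIdeals.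
End ModuleFinite.

(** * From module finite subalgebras to quasi-finite algebras *)

Section Subalgebra.
Variables (R : comPzRingType) (A : pzRingType) (phi : {rmorphism R -> A}).
Variables (B : set A) (hB : is_subalgebra phi B).

Definition subalg_pred of is_subalgebra phi B : {pred A} := fun x => `[< B x >].

Lemma subalg_predP x : reflect (B x) (x \in subalg_pred hB).
Proof. exact: asboolP. Qed.

Lemma subalg_pred_closed : subring_closed (subalg_pred hB).
Proof.
have [B1 BB BM _] := hB; split=> [|x y|x y]; first exact/subalg_predP.
  by move=> /subalg_predP Bx /subalg_predP By; apply/subalg_predP/BB.
by move=> /subalg_predP Bx /subalg_predP By; apply/subalg_predP/BM.
Qed.

HB.instance Definition _ :=
  GRing.isSubringClosed.Build A (subalg_pred hB) subalg_pred_closed.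

Definition subalg := {x : A | x \in subalg_pred hB}.
HB.instance Definition _ := [isSub for @sval A (fun x => x \in subalg_pred hB) : subalg -> A].
HB.instance Definition _ := [Choice of subalg by <:].
HB.instance Definition _ := GRing.SubChoice_isSubPzRing.Build A (subalg_pred hB) subalg
  subalg_pred_closed.

Lemma subalg_phi_subproof r : phi r \in subalg_pred hB.
Proof. by apply/subalg_predP; rewrite -[phi r]mulr1; have [B1 _ _] := hB; apply. Qed.

Definition subalg_phi r : subalg := Sub (phi r) (subalg_phi_subproof r).

Lemma subalg_phi_zmod : zmod_morphism subalg_phi.
Proof. by move=> r s; apply: val_inj; rewrite /= rmorphB. Qed.

Lemma subalg_phi_monoid : monoid_morphism subalg_phi.
Proof.
by split=> [|r s]; apply: val_inj; rewrite /= ?rmorph1 ?rmorphM.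
Qed.

HB.instance Definition _ :=
  GRing.isZmodMorphism.Build R subalg subalg_phi subalg_phi_zmod.
HB.instance Definition _ :=
  GRing.isMonoidMorphism.Build R subalg subalg_phi subalg_phi_monoid.

End Subalgebra.

(** Only [X] and [V] are involved, and by directedness one module finite subalgebra contains both;
    the relations found there persist in [A]. *)
Lemma quasi_finite_unit (R : comPzRingType) (A : pzRingType)
    (phi : {rmorphism R -> A}) (m : ideal R) (X V : A) :
  central_morphism phi -> quasi_finite phi -> maximal_ideal m ->
  exists d W r, [/\ ~ m r, (X + d * (1 - V * X)) * W = phi r
                 & W * (X + d * (1 - V * X)) = phi r].
Proof.
move=> phiC [J [le [B [_ [_ letr] leJ leB [Bfin Bcov]]]]] mmax.
have [i [BX BV]] : exists i, B i X /\ B i V.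
  have [iX _ BX] : (\bigcup_(i in setT) B i) X by rewrite Bcov.
  have [iV _ BV] : (\bigcup_(i in setT) B i) V by rewrite Bcov.
  by have [i [Xi Vi]] := leJ iX iV; exists i; split; apply: leB BX || apply: leB BV.
have [hB [k [b [Bb bspan]]]] := Bfin i.
pose T : pzRingType := subalg hB.
pose psi : {rmorphism R -> T} := @subalg_phi _ _ _ _ hB.
have BT x : B i x -> x \in subalg_pred hB by move/(subalg_predP hB).
pose bT j : T := Sub (b j) (BT _ (Bb j)).
have psiC : central_morphism psi.
  by move=> r a; apply: val_inj; rewrite /= phiC.
have bTspan (x : T) : exists r : 'I_k -> R, x = \sum_j psi (r j) * bT j.
  have [r e] := bspan (val x) (elimT (subalg_predP hB _) (valP x)).
  by exists r; apply: val_inj; rewrite e rmorph_sum.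
have [d [W [r [mr e1 e2]]]] :=
  unimodular_unit psiC bTspan mmax (Sub X (BT _ BX)) (Sub V (BT _ BV)).
exists (val d), (val W), r; split=> //.
- by have /(congr1 val) := e1.
- by have /(congr1 val) := e2.
Qed.

(** * Commutator calculus and quotients of abstract groups *)

Section GroupTheory.
Variable G : groupType.
Implicit Types (x y z g : G) (S H K N D : set G).
Local Open Scope group_scope.

Lemma comm_eltMl x y z : comm_elt (x * y) z = x * comm_elt y z * x^-1 * comm_elt x z.
Proof. by rewrite /comm_elt invgM !mulgA !mulgVK. Qed.

Lemma comm_eltMr x y z : comm_elt x (y * z) = comm_elt x y * (y * comm_elt x z * y^-1).
Proof. by rewrite /comm_elt invgM !mulgA !mulgVK. Qed.

Lemma comm_eltV x y : (comm_elt x y)^-1 = comm_elt y x.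
Proof. by rewrite /comm_elt !invgM !invgK !mulgA. Qed.

Lemma comm_eltVl x y : comm_elt x^-1 y = x^-1 * (comm_elt x y)^-1 * x^-1^-1.
Proof. by rewrite comm_eltV /comm_elt !invgK !mulgA mulgVK. Qed.

Lemma comm_eltVr x y : comm_elt x y^-1 = y^-1 * (comm_elt x y)^-1 * y^-1^-1.
Proof. by rewrite comm_eltV /comm_elt !invgK !mulgA mulVg mul1g. Qed.

Lemma conjVK g x : g * (g^-1 * x * g^-1^-1) * g^-1 = x.
Proof. by rewrite invgK !mulgA mulgV mul1g mulgK. Qed.

Lemma comm_eltJ g x y :
  g * comm_elt x y * g^-1 = comm_elt (g * x * g^-1) (g * y * g^-1).
Proof. by rewrite /comm_elt !invgM !invgK !mulgA !mulgVK. Qed.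

Lemma comm_eltE x y : comm_elt x y = x * (y * x * y^-1)^-1.
Proof. by rewrite /comm_elt !invgM invgK !mulgA. Qed.

(** If conjugation by [w] takes [x] to [x * x2] and [y] to [y * y2], the left side is the commutator
    of [comm_elt x y] with [w]. The factor [comm_elt x y] cancels, leaving conjugates of commutators
    that involve [x2] or [y2]. *)
Lemma comm_elt_expand x y x2 y2 :
  comm_elt x y * (comm_elt (x * x2) (y * y2))^-1 =
  (x * y * x^-1 * (x * comm_elt x2 y2 * x^-1 * comm_elt x y2) * (x * y * x^-1)^-1)^-1
  * (x * comm_elt x2 y * x^-1)^-1.
Proof.
rewrite comm_eltMl [comm_elt x2 _]comm_eltMr [comm_elt x (y * y2)]comm_eltMr.
move: (comm_elt x2 y) (comm_elt x2 y2) (comm_elt x y2) => c d e.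
rewrite /comm_elt !invgM !invgK !mulgA.
by do !rewrite ?mulgVK ?mulgK.
Qed.

Lemma comm_elt1 x : comm_elt x 1 = 1.
Proof. by rewrite /comm_elt invg1 !mulg1 mulgV. Qed.

Lemma comm_1elt x : comm_elt 1 x = 1.
Proof. by rewrite -comm_eltV comm_elt1 invg1. Qed.

Lemma comm_elt_eq1 x y : x * y = y * x -> comm_elt x y = 1.
Proof. by rewrite /comm_elt => ->; rewrite mulgK mulgV. Qed.

Lemma subgroup_gen_group S : is_subgroup (subgroup_gen S).
Proof.
split=> [H [[H1 _ _] _] //|x y Sx Sy H HS|x Sx H HS].
- by have [[_ HM _] _] := HS; exact: (HM _ _ (Sx H HS) (Sy H HS)).
- by have [[_ _ HV] _] := HS; exact: (HV _ (Sx H HS)).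
Qed.

Lemma mem_subgroup_gen S x : S x -> subgroup_gen S x.
Proof. by move=> Sx; apply: sub_gen_smallest. Qed.

Lemma subgroup_gen_min S H : is_subgroup H -> S `<=` H -> subgroup_gen S `<=` H.
Proof. exact: smallest_sub. Qed.

Definition normalizes S D : Prop := forall g x, S g -> D x -> D (g * x * g^-1).

Lemma normalizesT_gen S : (forall g x, S x -> S (g * x * g^-1)) ->
  normalizes setT (subgroup_gen S).
Proof.
move=> nS g x _ Sx.
pose H := [set x | subgroup_gen S (g * x * g^-1)].
have [S1 SM SV] := subgroup_gen_group S.
suff : subgroup_gen S `<=` H by apply.
apply: subgroup_gen_min => [|y Sy]; last exact: mem_subgroup_gen (nS _ _ Sy).
split=> [|y z Hy Hz|y Hy]; rewrite /H /=.
- by rewrite mulg1 mulgV.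
- have -> : g * (y * z) * g^-1 = (g * y * g^-1) * (g * z * g^-1).
    by rewrite !mulgA mulgVK.
  exact: SM.
- have -> : g * y^-1 * g^-1 = (g * y * g^-1)^-1 by rewrite !invgM invgK mulgA.
  exact: SV.
Qed.

Lemma comm_subgroup_group H K : is_subgroup (comm_subgroup H K).
Proof. exact: subgroup_gen_group. Qed.

Lemma mem_comm_subgroup H K x y : H x -> K y -> comm_subgroup H K (comm_elt x y).
Proof. by move=> Hx Ky; apply: mem_subgroup_gen; exists x, y. Qed.

Lemma comm_subgroup_min H K D : is_subgroup D ->
  (forall x y, H x -> K y -> D (comm_elt x y)) -> comm_subgroup H K `<=` D.
Proof.
by move=> gD DHK; apply: subgroup_gen_min => // _ [x [y [Hx Ky ->]]]; apply: DHK.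
Qed.

Lemma comm_subgroup_normal H K : normalizes setT H -> normalizes setT K ->
  normalizes setT (comm_subgroup H K).
Proof.
move=> nH nK; apply: normalizesT_gen => g _ [x [y [Hx Ky ->]]].
by exists (g * x * g^-1), (g * y * g^-1); split; [apply: nH|apply: nK|apply: comm_eltJ].
Qed.

Section Quotient.
Variables (N : set G).
Hypotheses (gN : is_subgroup N) (nN : normalizes setT N).

Definition coset_rel of is_subgroup N & normalizes setT N : rel G :=
  fun x y => `[< N (x * y^-1) >].

Lemma coset_rel_equiv : equiv_class_of (coset_rel gN nN).
Proof.
have [N1 NM NV] := gN; split=> [x|x y|y x z].
- by apply/asboolP; rewrite mulgV.
- by apply/asboolP/asboolP => /NV; rewrite invgM invgK.
- by move=> /asboolP Nxy /asboolP Nyz; apply/asboolP;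
    have := NM _ _ Nxy Nyz; rewrite mulgA mulgVK.
Qed.

Canonical coset_equiv := EquivRelPack coset_rel_equiv.

Definition coset := {eq_quot coset_equiv}%qT.
HB.instance Definition _ := Choice.on coset.

Local Notation cpi := (\pi_(coset)%qT).

Lemma coset_eqP x y : cpi x = cpi y <-> N (x * y^-1).
Proof.
split=> [/eqmodP/asboolP //|Nxy].
by apply/eqmodP/asboolP.
Qed.

Definition coset_mul (a b : coset) : coset := cpi (repr a * repr b).
Definition coset_inv (a : coset) : coset := cpi (repr a)^-1.

Lemma coset_piM x y : cpi (x * y) = coset_mul (cpi x) (cpi y).
Proof.
have [N1 NM NV] := gN.
have e z : N (z * (repr (cpi z))^-1) by apply/coset_eqP; rewrite reprK.
apply/coset_eqP; set x' := repr _; set y' := repr _.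
have -> : x * y * (x' * y')^-1 = x * (y * y'^-1) * x^-1 * (x * x'^-1).
  by rewrite invgM !mulgA mulgVK.
exact: NM (nN I (e y)) (e x).
Qed.

Lemma coset_piV x : cpi x^-1 = coset_inv (cpi x).
Proof.
apply/coset_eqP; set x' := repr _; rewrite invgK.
have Nx : N (x' * x^-1) by apply/coset_eqP; rewrite reprK.
by have := nN I Nx (g := x^-1); rewrite invgK mulgA mulgVK.
Qed.

Lemma coset_surj (a : coset) : exists x, a = cpi x.
Proof. by exists (repr a); rewrite reprK. Qed.

Lemma coset_mulA : associative coset_mul.
Proof.
move=> a b c; have [[x ->] [y ->] [z ->]] := And3 (coset_surj a) (coset_surj b) (coset_surj c).
by rewrite -(coset_piM y z) -(coset_piM x y) -(coset_piM x) -(coset_piM _ z) mulgA.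
Qed.
Lemma coset_mul1 : left_id (cpi 1) coset_mul.
Proof. by move=> a; have [x ->] := coset_surj a; rewrite -(coset_piM 1 x) mul1g. Qed.
Lemma coset_1mul : right_id (cpi 1) coset_mul.
Proof. by move=> a; have [x ->] := coset_surj a; rewrite -(coset_piM x 1) mulg1. Qed.
Lemma coset_mulV : left_inverse (cpi 1) coset_inv coset_mul.
Proof.
move=> a; have [x ->] := coset_surj a.
by rewrite -(coset_piV x) -(coset_piM _ x) mulVg.
Qed.
Lemma coset_Vmul : right_inverse (cpi 1) coset_inv coset_mul.
Proof.
move=> a; have [x ->] := coset_surj a.
by rewrite -(coset_piV x) -(coset_piM x) mulgV.
Qed.

HB.instance Definition _ :=
  isGroup.Build coset coset_mulA coset_mul1 coset_1mul coset_mulV coset_Vmul.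

(** Turns congruences modulo [N] into equalities in a group; a morphism and its kernel are all that
    the later computations use. *)
Lemma quotient_group : exists (Q : groupType) (pi : G -> Q),
  (forall x y, pi (x * y) = pi x * pi y) /\ (forall x, pi x = 1 <-> N x).
Proof.
exists (coset : groupType), cpi; split=> [|x]; first exact: coset_piM.
by rewrite -[1]/(cpi 1) coset_eqP invg1 mulg1.
Qed.

End Quotient.
End GroupTheory.

Section GroupMorphism.
Variables (G Q : groupType) (pi : G -> Q).
Hypothesis piM : forall x y, pi (x * y)%g = (pi x * pi y)%g.
Local Open Scope group_scope.

Lemma morph1 : pi 1 = 1.
Proof. by apply: (mulgI (pi 1)); rewrite -piM !mulg1. Qed.

Lemma morphV x : pi x^-1 = (pi x)^-1.
Proof. by apply: (mulgI (pi x)); rewrite -piM !mulgV morph1. Qed.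

Lemma morph_comm x y : pi (comm_elt x y) = comm_elt (pi x) (pi y).
Proof. by rewrite /comm_elt !piM !morphV. Qed.

End GroupMorphism.

(** * Matrices [1 + M] with [M] of square zero *)

Section Unipotent.
Variables (n : nat) (A : pzRingType).
Local Notation mx := 'M[A]_n.
Local Notation GL := (GL n A).
Implicit Types (M N : mx) (g h : GL).

Lemma uvalM g h : uval (g * h)%g = uval g * uval h. Proof. by []. Qed.
Lemma uvalV g : uval g^-1%g = uinv g. Proof. by []. Qed.
Lemma unip_subproof M : M * M = 0 -> (1 + M) * (1 - M) = 1.
Proof. by move=> M2; rewrite mulrBr mulr1 mulrDl mul1r M2 addr0 addrK. Qed.

Lemma unip_subproof' M : M * M = 0 -> (1 - M) * (1 + M) = 1.
Proof. by move=> M2; rewrite mulrDr mulr1 mulrBl mul1r M2 subr0 subrK. Qed.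

(* Junk value 1 when M * M != 0. *)
Definition unip M : GL :=
  if (M * M =P 0) is ReflectT M2 then mk_unit (unip_subproof M2) (unip_subproof' M2)
  else 1%g.

Lemma uval_unip M : M * M = 0 -> uval (unip M) = 1 + M.
Proof. by move=> M2; rewrite /unip; case: eqP. Qed.

Lemma uinv_unip M : M * M = 0 -> uinv (unip M) = 1 - M.
Proof. by move=> M2; rewrite /unip; case: eqP. Qed.

Lemma unip0 : unip 0 = 1%g.
Proof. by apply: uval_inj; rewrite uval_unip ?mulr0 // addr0. Qed.

Lemma unipN M : M * M = 0 -> unip (- M) = (unip M)^-1%g.
Proof.
by move=> M2; apply: uval_inj; rewrite uvalV uinv_unip // uval_unip // mulrNN.
Qed.

Lemma unipD M N : M * M = 0 -> N * N = 0 -> M * N = 0 -> N * M = 0 ->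
  unip (M + N) = (unip M * unip N)%g.
Proof.
move=> M2 N2 MN NM; apply: uval_inj; rewrite uvalM !uval_unip //.
  by rewrite mulrDl mul1r mulrDr mulr1 MN addr0 -addrA [N + M]addrC.
by rewrite mulrDl !mulrDr M2 N2 MN NM !addr0.
Qed.

Lemma unipJ g M : M * M = 0 ->
  (g * unip M * g^-1)%g = unip (uval g * M * uinv g).
Proof.
move=> M2; have J2 : uval g * M * uinv g * (uval g * M * uinv g) = 0.
  by rewrite -!mulrA (mulrA (uinv g)) uinvK mul1r (mulrA M) M2 mul0r mulr0.
apply: uval_inj; rewrite !uvalM uvalV !uval_unip //.
by rewrite mulrDr mulr1 mulrDl uvalK.
Qed.

Lemma unip_comm M N : M * M = 0 -> N * N = 0 -> N * M = 0 ->
  comm_elt (unip M) (unip N) = unip (M * N).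
Proof.
move=> M2 N2 NM; apply: uval_inj.
rewrite /comm_elt !uvalM !uvalV !uinv_unip // !uval_unip //; last first.
  by rewrite mulrA -(mulrA M) NM mulr0 mul0r.
have -> : (1 + M) * (1 + N) * (1 - M) = 1 + N + M * N.
  have e : (1 + N) * (1 - M) = 1 + N - M.
    by rewrite mulrBr mulr1 [(1 + N) * M]mulrDl mul1r NM addr0.
  rewrite -mulrA e [LHS]mulrDl mul1r mulrBr mulrDr mulr1 M2 subr0 addrA.
  by rewrite subrK.
rewrite mulrBr mulr1 [(_ + M * N) * N]mulrDl [(1 + N) * N]mulrDl mul1r N2.
by rewrite -mulrA N2 mulr0 !addr0 addrAC addrK.
Qed.

(** The general expansion, where neither product vanishes. It applies both to [[e_ij, e_ji]] and to
    its transform by [U] and [V], which can then be compared as polynomials in two matrices. *)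
Lemma unip_commM M N : M * M = 0 -> N * N = 0 ->
  uval (comm_elt (unip M) (unip N)) =
  1 + (M * N - N * M - M * N * M + N * M * N + M * N * M * N).
Proof.
move=> M2 N2; rewrite /comm_elt !uvalM !uvalV !uinv_unip // !uval_unip //.
pose Z := M * N - N * M - M * N * M.
have -> : (1 + M) * (1 + N) * (1 - M) = 1 + N + Z.
  have e : (1 + N) * (1 - M) = 1 + N - M - N * M.
    by rewrite mulrBr mulr1 [(1 + N) * M]mulrDl mul1r opprD addrA.
  have e' : M * (1 + N - M - N * M) = M + (M * N - M * N * M).
    by rewrite !mulrBr mulrDr mulr1 M2 subr0 mulrA addrA.
  rewrite -mulrA e [LHS]mulrDl mul1r e' [1 + N - M - _]addrAC addrA subrK /Z.
  by rewrite -!addrA; do 2!congr (_ + _); rewrite addrCA.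
have ZN : Z * N = - (N * M * N) - M * N * M * N.
  by rewrite /Z !mulrBl -(mulrA M N N) N2 mulr0 sub0r.
rewrite mulrBr mulr1 [(1 + N + Z) * N]mulrDl [(1 + N) * N]mulrDl mul1r N2 addr0.
by rewrite ZN opprD addrA [1 + N + Z]addrAC addrK opprD !opprK /Z !addrA.
Qed.

End Unipotent.

(** * Elementary matrices and the level ideal of a subgroup *)

Section Elementary.
Variables (n : nat) (A : pzRingType).
Local Notation mx := 'M[A]_n.
Local Notation GL := (GL n A).
Implicit Types (i j k l p : 'I_n) (a b x : A) (M N : mx).

Definition smx i j a : mx := \matrix_(k, l) (if (k == i) && (l == j) then a else 0).

Lemma smx0 i j : smx i j 0 = 0.
Proof. by apply/matrixP => k l; rewrite !mxE if_same. Qed.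

Lemma smxD i j a b : smx i j (a + b) = smx i j a + smx i j b.
Proof. by apply/matrixP => k l; rewrite !mxE; case: ifP; rewrite ?addr0. Qed.

Lemma smxN i j a : smx i j (- a) = - smx i j a.
Proof. by apply/matrixP => k l; rewrite !mxE; case: ifP; rewrite ?oppr0. Qed.

Lemma smx_mulE i j a M k l : (smx i j a * M) k l = if k == i then a * M j l else 0.
Proof.
rewrite mxE (bigD1 j) //= big1 => [|m mj]; last by rewrite mxE (negPf mj) andbF mul0r.
by rewrite addr0 mxE eqxx andbT; case: ifP; rewrite ?mul0r.
Qed.

Lemma mul_smxE M i j a k l : (M * smx i j a) k l = if l == j then M k i * a else 0.
Proof.
rewrite mxE (bigD1 i) //= big1 => [|m mj]; last by rewrite mxE (negPf mj) mulr0.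
by rewrite addr0 mxE eqxx /=; case: ifP; rewrite ?mulr0.
Qed.

Lemma mul_smx_mulE M N i j x k l : (M * (smx i j x * N)) k l = M k i * (x * N j l).
Proof.
rewrite mxE (bigD1 i) //= big1 => [|m mi]; rewrite smx_mulE ?eqxx ?addr0 //.
by rewrite (negPf mi) mulr0.
Qed.

Lemma smxM i j l a b : smx i j a * smx j l b = smx i l (a * b).
Proof.
by apply/matrixP => x y; rewrite smx_mulE !mxE eqxx; case: (x == i); case: (y == l);
  rewrite ?mulr0.
Qed.

Lemma smxM0 i j k l a b : j != k -> smx i j a * smx k l b = 0.
Proof.
by move=> jk; apply/matrixP => x y; rewrite smx_mulE !mxE (negPf jk) mulr0 if_same.
Qed.

Lemma mx_sum_smx M : M = \sum_k \sum_l smx k l (M k l).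
Proof.
apply/matrixP => i j; rewrite summxE (bigD1 i) //= [X in _ + X]big1 => [|k ki]; last first.
  by rewrite summxE big1 // => l _; rewrite mxE eq_sym (negPf ki).
rewrite addr0 summxE (bigD1 j) //= big1 => [|l lj]; last first.
  by rewrite mxE [j == l]eq_sym (negPf lj) andbF.
by rewrite addr0 mxE !eqxx.
Qed.

Definition el i j a : GL := unip (smx i j a).

Lemma smx_sq i j a : i != j -> smx i j a * smx i j a = 0.
Proof. by move=> ij; rewrite smxM0 // eq_sym. Qed.

Lemma el_elem i j (ij : i != j) a : el i j a = elem ij a.
Proof.
apply: uval_inj; rewrite uval_unip ?smx_sq //.
by apply/matrixP => k l; rewrite !mxE.
Qed.

Lemma el0 i j : el i j 0 = 1%g.
Proof. by rewrite /el smx0 unip0. Qed.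

Lemma elD i j a b : i != j -> el i j (a + b) = (el i j a * el i j b)%g.
Proof.
by move=> ij; rewrite /el smxD unipD ?smx_sq // smxM0 // eq_sym.
Qed.

Lemma elN i j a : i != j -> el i j (- a) = (el i j a)^-1%g.
Proof. by move=> ij; rewrite /el smxN unipN ?smx_sq. Qed.

Lemma comm_el i j l a b : i != j -> j != l -> i != l ->
  comm_elt (el i j a) (el j l b) = el i l (a * b).
Proof.
by move=> ij jl il; rewrite /el unip_comm ?smx_sq ?smxM // smxM0 // eq_sym.
Qed.

Lemma comm_el1 i j k l a b : i != j -> k != l -> j != k -> l != i ->
  comm_elt (el i j a) (el k l b) = 1%g.
Proof.
by move=> ij kl jk li; rewrite /el unip_comm ?smx_sq ?smxM0 ?unip0.
Qed.

Section Block.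
Variable S : pred 'I_n.

(** Rows in [S], columns outside [S]: products of two such matrices vanish, so the [1 + M] form the
    abelian unipotent radical of a parabolic subgroup. *)
Definition block M : Prop := forall k l, ~~ (S k && ~~ S l) -> M k l = 0.

Lemma block0 : block 0. Proof. by move=> k l _; rewrite mxE. Qed.

Lemma blockD M N : block M -> block N -> block (M + N).
Proof. by move=> bM bN k l kl; rewrite mxE bM // bN // addr0. Qed.

Lemma block_mul M N : block M -> block N -> M * N = 0.
Proof.
move=> bM bN; apply/matrixP => i j; rewrite !mxE big1 // => k _.
by case Sk : (S k); [rewrite bM ?mul0r // Sk andbF | rewrite bN ?mulr0 // Sk].
Qed.

Lemma block_smx k l a : S k -> ~~ S l -> block (smx k l a).
Proof.
move=> Sk Sl i j; rewrite mxE; case: ifP => // /andP[/eqP-> /eqP->].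
by rewrite Sk Sl.
Qed.

Lemma unip_block_mem (D : set GL) M : is_subgroup D -> block M ->
  (forall k l, S k -> ~~ S l -> D (el k l (M k l))) -> D (unip M).
Proof.
case=> D1 DM _ bM DE; rewrite (mx_sum_smx M).
suff [] : block (\sum_k \sum_l smx k l (M k l)) /\ D (unip (\sum_k \sum_l smx k l (M k l))) by [].
have PD N N' : block N /\ D (unip N) -> block N' /\ D (unip N') ->
    block (N + N') /\ D (unip (N + N')).
  move=> [bN DN] [bN' DN']; split; first exact: blockD.
  by rewrite unipD ?block_mul //; apply: DM.
have P0 : block 0 /\ D (unip 0) by split; [exact: block0 | rewrite unip0].
elim/big_ind: _ => // k _; elim/big_ind: _ => // l _.
have [/andP[Sk Sl]|kl] := boolP (S k && ~~ S l).
  by split; [exact: block_smx | exact: DE].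
by rewrite bM // smx0.
Qed.

End Block.

Section Level.
Variables (D : set GL) (gD : is_subgroup D).

(** The largest two-sided ideal all of whose elementary matrices lie in [D]; the multiples
    [x * c * y] make it an ideal for every subgroup [D]. *)
Definition level_set : set A :=
  [set c | forall k l x y, k != l -> D (el k l (x * c * y))].

Lemma level0 : level_set 0.
Proof. by move=> k l x y _; rewrite mulr0 mul0r el0; have [] := gD. Qed.

Lemma levelB c d : level_set c -> level_set d -> level_set (c - d).
Proof.
have [_ DM DV] := gD.
move=> Dc Dd k l x y kl; rewrite mulrBr mulrBl elD // elN //.
by apply: DM; [apply: Dc | apply/DV/Dd].
Qed.

Lemma levelMl a c : level_set c -> level_set (a * c).
Proof. by move=> Dc k l x y kl; rewrite mulrA; apply: Dc. Qed.

Lemma levelMr a c : level_set c -> level_set (c * a).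
Proof. by move=> Dc k l x y kl; rewrite mulrA -[_ * a * y]mulrA; apply: Dc. Qed.

Definition level : ideal A := Ideal level0 levelB levelMl levelMr.

Lemma level_el k l c : level c -> k != l -> D (el k l c).
Proof. by move=> Dc kl; have := Dc k l 1 1 kl; rewrite mul1r mulr1. Qed.

End Level.

End Elementary.

(** * Matrices over an ideal; elementary and congruence subgroups *)

Section IdealMatrices.
Variables (n : nat) (A : pzRingType).
Implicit Types (I J L : ideal A) (M N : 'M[A]_n).

Definition mx_in I M : Prop := forall i j, I (M i j).

Lemma mx_in0 I : mx_in I 0. Proof. by move=> i j; rewrite mxE; apply: ideal0. Qed.

Lemma mx_inD I M N : mx_in I M -> mx_in I N -> mx_in I (M + N).
Proof. by move=> IM IN i j; rewrite mxE; apply: idealD. Qed.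

Lemma mx_inN I M : mx_in I M -> mx_in I (- M).
Proof. by move=> IM i j; rewrite mxE; apply: idealN. Qed.

Lemma mx_inB I M N : mx_in I M -> mx_in I N -> mx_in I (M - N).
Proof. by move=> IM IN; apply: mx_inD => //; apply: mx_inN. Qed.

Lemma mx_inMl I M N : mx_in I N -> mx_in I (M * N).
Proof. by move=> IN i j; rewrite mxE; apply: ideal_sum => k _; apply: idealMl. Qed.

Lemma mx_inMr I M N : mx_in I M -> mx_in I (M * N).
Proof. by move=> IM i j; rewrite mxE; apply: ideal_sum => k _; apply: idealMr. Qed.

Lemma mx_in_mul I J L M N : (forall a b, I a -> J b -> L (a * b)) ->
  mx_in I M -> mx_in J N -> mx_in L (M * N).
Proof. by move=> IJL IM JN i j; rewrite mxE; apply: ideal_sum => k _; apply: IJL. Qed.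

Lemma mx_in_smx I i j a : I a -> mx_in I (smx i j a).
Proof. by move=> Ia k l; rewrite mxE; case: ifP => // _; apply: ideal0. Qed.

Lemma scalar_mx_central (r : A) M : (forall a, r * a = a * r) ->
  r%:M * M = M * r%:M.
Proof.
move=> rC; rewrite -!mulmxE mul_scalar_mx; apply/matrixP => i j; rewrite !mxE.
rewrite (bigD1 j) //= big1 => [|k kj]; rewrite !mxE ?eqxx ?mulr1n ?addr0 ?rC //.
by rewrite (negPf kj) mulr0.
Qed.

Lemma scalar_mxM_smx (r : A) i j a : r%:M * smx i j a = smx i j (r * a) :> 'M_n.
Proof.
rewrite -mulmxE mul_scalar_mx; apply/matrixP => k l; rewrite !mxE.
by case: ifP; rewrite ?mulr0.
Qed.

End IdealMatrices.

Definition idealT (A : pzRingType) : ideal A :=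
  @Ideal A setT Logic.I (fun _ _ _ _ => Logic.I) (fun _ _ _ => Logic.I)
    (fun _ _ _ => Logic.I).

Section Subgroups.
Variables (n : nat) (A : pzRingType).
Local Notation GL := (GL n A).
Local Notation EA := (E n (setT : set A)).
Implicit Types (I J K : ideal A) (D : set GL).

Lemma E_group (X : set A) : is_subgroup (E n X).
Proof. exact: subgroup_gen_group. Qed.

Lemma E_el (X : set A) i j a : i != j -> X a -> E n X (el i j a).
Proof.
by move=> ij Xa; apply: mem_subgroup_gen; exists i, j, ij, a; rewrite el_elem.
Qed.

Lemma E_min (X : set A) D : is_subgroup D ->
  (forall i j a, i != j -> X a -> D (el i j a)) -> E n X `<=` D.
Proof.
move=> gD DE; apply: subgroup_gen_min => // _ [i [j [ij [a [Xa ->]]]]].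
by rewrite -el_elem; apply: DE.
Qed.

Lemma relE_group I : is_subgroup (relE n I).
Proof. exact: subgroup_gen_group. Qed.

Lemma relE_el I i j a : i != j -> I a -> relE n I (el i j a).
Proof.
move=> ij Ia; apply: mem_subgroup_gen; exists 1%g, (el i j a); split.
- by have [] := E_group setT.
- exact: E_el.
- by rewrite invg1 mul1g mulg1.
Qed.

Lemma relE_normal I : normalizes EA (relE n I).
Proof.
move=> g x Eg; have [E1 EM EV] := E_group setT.
have [_ RM RV] := relE_group I.
pose H := [set x | relE n I (g * x * g^-1)%g].
suff : relE n I `<=` H by apply.
apply: subgroup_gen_min => [|_ [k [s [Ek Es ->]]]]; last first.
  apply: mem_subgroup_gen; exists (g * k)%g, s; split=> //; first exact: EM.
  by rewrite invgM !mulgA.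
split=> [|y z Hy Hz|y Hy]; rewrite /H /=.
- by rewrite mulg1 mulgV; have [] := relE_group I.
- have -> : (g * (y * z) * g^-1 = (g * y * g^-1) * (g * z * g^-1))%g.
    by rewrite !mulgA mulgVK.
  exact: RM.
- have -> : (g * y^-1 * g^-1 = (g * y * g^-1)^-1)%g by rewrite !invgM invgK mulgA.
  exact: RV.
Qed.

Lemma relE_min I D : is_subgroup D -> normalizes EA D ->
  (forall i j a, i != j -> I a -> D (el i j a)) -> relE n I `<=` D.
Proof.
move=> gD nD DE; apply: subgroup_gen_min => // _ [k [s [Ek Es ->]]].
by apply: nD => //; apply: (E_min gD DE).
Qed.

Lemma relE_EA I : relE n I `<=` EA.
Proof.
have [E1 EM EV] := E_group setT; apply: relE_min => [||i j a ij _].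
- exact: E_group.
- by move=> g x Eg Ex; apply: (EM); [apply: (EM)|apply: EV].
- exact: E_el.
Qed.

Lemma EA_relE : EA `<=` relE n (idealT A).
Proof. by apply: E_min => [|i j a ij _]; [apply: relE_group | apply: relE_el]. Qed.

Lemma congGL_mx I g : congGL n I g <-> mx_in I (uval g - 1).
Proof.
rewrite congGLP; split=> gI i j; first by have := gI i j; rewrite !mxE.
by have := gI i j; rewrite !mxE.
Qed.

Lemma congGL_group I : is_subgroup (congGL n I).
Proof.
split=> [|g h /congGL_mx Ig /congGL_mx Ih|g /congGL_mx Ig]; apply/congGL_mx.
- by rewrite subrr; apply: mx_in0.
- rewrite uvalM; have -> : uval g * uval h - 1 = (uval g - 1) * uval h + (uval h - 1).
    by rewrite mulrBl mul1r addrA subrK.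
  by apply: mx_inD => //; apply: mx_inMr.
- rewrite uvalV; have -> : uinv g - 1 = - (uinv g * (uval g - 1)).
    by rewrite mulrBr uinvK mulr1 opprB.
  by apply/mx_inN/mx_inMl.
Qed.

Lemma congGL_inv_mx I g : congGL n I g -> mx_in I (uinv g - 1).
Proof.
by move=> Ig; have [_ _ /(_ _ Ig)/congGL_mx] := congGL_group I; rewrite uvalV.
Qed.

Lemma congGL_normal I : normalizes setT (congGL n I).
Proof.
move=> g x _ /congGL_mx Ix; apply/congGL_mx; rewrite !uvalM uvalV.
have -> : uval g * uval x * uinv g - 1 = uval g * (uval x - 1) * uinv g.
  by rewrite mulrBr mulrBl mulr1 uvalK.
by apply/mx_inMr/mx_inMl.
Qed.

Lemma congGL_el I i j a : i != j -> I a -> congGL n I (el i j a).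
Proof.
move=> ij Ia; apply/congGL_mx; rewrite uval_unip ?smx_sq // addrC addKr.
exact: mx_in_smx.
Qed.

Lemma relE_congGL I : relE n I `<=` congGL n I.
Proof.
apply: relE_min => [||i j a]; [exact: congGL_group | | exact: congGL_el].
by move=> g x _; apply: congGL_normal.
Qed.

Lemma congGLT g : congGL n (idealT A) g.
Proof. by apply/congGL_mx => i j. Qed.

End Subgroups.

(** All uses of [n >= 3] go through this spare index. *)
Lemma third_index n (i j : 'I_n) : (3 <= n)%N -> exists p, p != i /\ p != j.
Proof.
move=> hn; have : (#|[set i; j]%SET| < #|'I_n|)%N.
  by rewrite cardsU1 cards1 card_ord; case: (_ \notin _); rewrite //= ltnW.
rewrite -cardsT => lt.
have /subsetPn[p _] : ~~ ([set: 'I_n]%SET \subset [set i; j]%SET).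
  by apply/negP => /subset_leq_card; rewrite leqNgt lt.
by rewrite !finset.inE negb_or => /andP[]; exists p.
Qed.

(** * Transvections along a scaled column *)

Section Tau.
Variables (n : nat) (A : pzRingType) (hn : (3 <= n)%N).
Local Notation GL := (GL n A).
Local Notation EA := (E n (setT : set A)).
Variables (D : set GL) (gD : is_subgroup D) (nD : normalizes EA D).
(* C stands for the p-th column of an invertible matrix, scaled on the right so
   that its p-th entry is r. *)
Variables (p : 'I_n) (r : A) (rC : forall a, r * a = a * r) (C : 'M[A]_n).
Local Notation P := (smx p p 1 : 'M[A]_n).
Local Notation rho := (r%:M : 'M[A]_n).
Hypotheses (CP : C * P = C) (PC : P * C = rho * P).

Let rhoC M : rho * M = M * rho. Proof. exact: scalar_mx_central. Qed.

Lemma comm_mem x y : D x -> EA y -> D (comm_elt x y).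
Proof.
have [_ DM DV] := gD; move=> Dx Ey.
have -> : comm_elt x y = (x * (y * x^-1 * y^-1))%g by rewrite /comm_elt !mulgA.
by apply: (DM) => //; apply: nD => //; apply: DV.
Qed.

Lemma mulCC : C * C = rho * C.
Proof. by rewrite -{1}CP -mulrA PC mulrA -rhoC -mulrA CP. Qed.

Lemma tau_ann : (rho - C) * C = 0.
Proof. by rewrite mulrBl mulCC subrr. Qed.

Lemma tau_mul0 V V' : C * V * (rho - C) * (C * V' * (rho - C)) = 0.
Proof. by rewrite -!mulrA (mulrA (rho - C)) tau_ann mul0r !mulr0. Qed.

(** For a row [V] the matrix [1 + C * V * (rho - C)] is a transvection: the row [V * (rho - C)]
    annihilates the column [C]. With [C] fixed it is multiplicative in [V], so [V] can be treated
    one entry at a time. *)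
Lemma tauD V V' : unip (C * (V + V') * (rho - C)) =
  (unip (C * V * (rho - C)) * unip (C * V' * (rho - C)))%g.
Proof. by rewrite [C * _]mulrDr mulrDl unipD ?tau_mul0. Qed.

Lemma Cpp : C p p = r.
Proof.
have /matrixP/(_ p p) := PC.
by rewrite scalar_mxM_smx smx_mulE !mxE eqxx mul1r mulr1.
Qed.

(** Only row [k] of [rho - C] matters, and there [C] agrees with [C1], its part in rows [p] and [k].
    The contribution of [C1] factors through the spare index [q] into a column and a row whose
    product in the opposite order vanishes, as [(rho - C1) * C1 = 0]; hence it is a commutator. The
    remaining rows of [C] give [t]. *)
Lemma tau_split k q g : k != p -> q != p -> q != k ->
  (forall l, l != p -> l != k -> level gD (C l p * g)) ->
  exists2 t, D t & unip (C * smx p k g * (rho - C)) =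
    (t * comm_elt (el p q (r * g) * el k q (C k p * g))
                  (el q k r * el q p (- C k p)))%g.
Proof.
move=> kp qp qk Dg.
have [C1 C1def] : exists C1, C1 = smx p p r + smx k p (C k p) by eexists.
have [C2 C2def] : exists C2, C2 = C - C1 by eexists.
have C1P : C1 * P = C1 by rewrite C1def mulrDl !smxM !mulr1.
have PC1 : P * C1 = rho * P.
  by rewrite C1def mulrDr smxM smxM0 1?eq_sym // addr0 scalar_mxM_smx mul1r mulr1.
have C2P : C2 * P = C2 by rewrite C2def mulrBl CP C1P.
have PC2 : P * C2 = 0 by rewrite C2def mulrBr PC PC1 subrr.
have C2E l : C2 l p = if (l != p) && (l != k) then C l p else 0.
  rewrite C2def C1def !mxE eqxx !andbT; have [->|lp] := eqVneq l p.
    by rewrite (eq_sym p) (negPf kp) addr0 Cpp subrr.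
  by have [->|lk] := eqVneq l k; rewrite add0r ?subrr // subr0.
have CE i j : C i j = if j == p then C i p else 0.
  by rewrite -[in LHS]CP mul_smxE mulr1.
have C1E j : C1 k j = if j == p then C k p else 0.
  by rewrite C1def !mxE (negPf kp) eqxx /= add0r.
set s := smx p k g.
have kC1 : s * (rho - C) = s * (rho - C1).
  apply/matrixP => i j; rewrite !smx_mulE; case: ifP => // _; congr (_ * _).
  by rewrite [LHS]mxE [RHS]mxE; congr (_ + _); rewrite [LHS]mxE [RHS]mxE CE C1E.
have C1C1 : C1 * C1 = rho * C1 by rewrite -{1}C1P -mulrA PC1 mulrA -rhoC -mulrA C1P.
have annC1 : (rho - C1) * C1 = 0 by rewrite mulrBl C1C1 subrr.
have sC2 : s * C2 = 0.
  apply/matrixP => i j; rewrite smx_mulE [RHS]mxE; case: ifP => // _.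
  by rewrite -[C2]C2P mul_smxE C2E eqxx andbF mul0r if_same mulr0.
have annC2 : s * ((rho - C1) * C2) = 0.
  rewrite mulrA mulrBr mulrBl -mulrA rhoC mulrA sC2 mul0r sub0r -!mulrA -C1P -mulrA PC2.
  by rewrite !mulr0 oppr0.
pose a := C2 * (s * (rho - C1)); pose b := C1 * (s * (rho - C1)).
have Us : C * s * (rho - C) = a + b.
  by rewrite -mulrA kC1 -mulrDl C2def subrK.
have a_ann M : a * (C2 * M) = 0 by rewrite /a -!mulrA (mulrA _ C2) (mulrA s) annC2 mul0r mulr0.
have a_ann' M : a * (C1 * M) = 0.
  by rewrite /a -!mulrA (mulrA _ C1) annC1 mul0r !mulr0.
have b_ann M : b * (C2 * M) = 0 by rewrite /b -!mulrA (mulrA _ C2) (mulrA s) annC2 mul0r mulr0.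
have b_ann' M : b * (C1 * M) = 0.
  by rewrite /b -!mulrA (mulrA _ C1) annC1 mul0r !mulr0.
exists (unip a).
  apply: (@unip_block_mem _ _ [pred l | (l != p) && (l != k)]) => //.
    move=> i j /=; rewrite /a mul_smx_mulE C2E.
    case: ifP => [_|_ _]; last by rewrite mul0r.
    rewrite /= negbK => /andP[jp jk]; rewrite !mxE C1E (negPf jp).
    by rewrite eq_sym (negPf jk) mulr0n subr0 !mulr0.
  move=> i j /= Si Sj; rewrite /a mul_smx_mulE C2E Si mulrA; case/andP: (Si) => ip ik.
  apply: (level_el (gD := gD)); first by apply: levelMr; apply: Dg.
  by apply: contraNneq Sj => <-.
rewrite Us unipD ?(a_ann, a_ann', b_ann, b_ann') //; congr (_ * _)%g.
have -> : b = C1 * smx p q g * (smx q k 1 * (rho - C1)).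
  by rewrite mulrA -(mulrA C1) smxM mulr1 -mulrA.
have ME : C1 * smx p q g = smx p q (r * g) + smx k q (C k p * g).
  by rewrite C1def mulrDl !smxM.
have NE : smx q k 1 * (rho - C1) = smx q k r + smx q p (- C k p).
  rewrite mulrBr -rhoC scalar_mxM_smx mulr1 C1def mulrDr smxM0 // smxM mul1r add0r.
  by rewrite smxN.
have elM : unip (C1 * smx p q g) = (el p q (r * g) * el k q (C k p * g))%g.
  by rewrite ME unipD ?smx_sq ?smxM0 // eq_sym.
have elN : unip (smx q k 1 * (rho - C1)) = (el q k r * el q p (- C k p))%g.
  by rewrite NE unipD ?smx_sq ?smxM0 // eq_sym.
rewrite -elM -elN unip_comm //.
- by rewrite ME mulrDl !mulrDr !smxM0 ?addr0 // eq_sym.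
- by rewrite NE mulrDl !mulrDr !smxM0 ?addr0 // eq_sym.
- by rewrite !mulrA -(mulrA (smx q k 1)) annC1 mulr0 mul0r.
Qed.

Lemma tau_level V : mx_in (level gD) V -> P * V = V -> V * P = 0 ->
  D (unip (C * V * (rho - C))).
Proof.
have [D1 DM DV] := gD; have [E1 EM EV] := E_group n (setT : set A).
move=> LV PV VP; rewrite (mx_sum_smx V).
elim/big_ind: _ => [||k _]; first by rewrite mulr0 mul0r unip0.
  by move=> x y Dx Dy; rewrite tauD; apply: DM.
elim/big_ind: _ => [||l _]; first by rewrite mulr0 mul0r unip0.
  by move=> x y Dx Dy; rewrite tauD; apply: DM.
have [->|kp] := eqVneq k p; last first.
  have -> : V k l = 0 by rewrite -PV smx_mulE (negPf kp).
  by rewrite smx0 mulr0 mul0r unip0.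
have [->|lp] := eqVneq l p.
  have -> : V p p = 0.
    by have /matrixP/(_ p p) := VP; rewrite mul_smxE eqxx mulr1 mxE.
  by rewrite smx0 mulr0 mul0r unip0.
have [q [qp ql]] := third_index p l hn.
have [t Dt ->] := tau_split lp qp ql (fun m _ _ => levelMl (C m p) (LV p l)).
apply: (DM) => //.
have lev x m m' : m != m' -> D (el m m' (x * V p l)).
  by apply: level_el; apply: levelMl; apply: LV.
have Dd : D (el p q (r * V p l) * el l q (C l p * V p l))%g.
  by apply: (DM); apply: lev; rewrite // eq_sym.
by apply: comm_mem => //; apply: (EM); apply: E_el.
Qed.

(** The main term is [[e_pq(r g), e_qk(r)] = e_pk(r g r)]. The other factors of the commutator in
    [tau_split] only contribute elements of [D]; the one that is not elementary is
    [[e_pq(r g), e_qp(- C k p)]], which the last hypothesis puts in [D]. *)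
Lemma tau_mod k g : k != p ->
  (forall l, l != p -> level gD (C l p * g)) ->
  (forall q, q != p -> D (comm_elt (el p q (r * g)) (el q p (- C k p)))) ->
  D (unip (C * smx p k g * (rho - C)) * (el p k (r * g * r))^-1)%g.
Proof.
have [D1 DM DV] := gD; have [E1 EM EV] := E_group n (setT : set A).
move=> kp Dg Dy; have [q [qp qk]] := third_index p k hn.
have pq : p != q by rewrite eq_sym.
have pk : p != k by rewrite eq_sym.
have kq : k != q by rewrite eq_sym.
have [t Dt ->] := tau_split kp qp qk (fun m mp _ => Dg m mp).
rewrite -mulgA; apply: (DM) => //.
set x := el p q _; set d := el k q _; set e := (el q k r * _)%g.
have Ee : EA e by apply: (EM); apply: E_el.
have Ex : EA x by apply: E_el.
have Dd : D d by apply: level_el kq; apply: Dg.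
have nDinv g' y : EA g' -> D y -> D (g' * y * g'^-1)%g by move=> ? ?; apply: nD.
rewrite comm_eltMl -mulgA; apply: (DM).
  by apply: nD => //; apply: comm_mem.
set y := el q p (- C k p); have Ey : EA y by apply: E_el.
have eE : e = (y * el q k r)%g.
  have /(congr1 (fun t => (t * y * el q k r)%g)) := comm_el1 r (- C k p) qk qp kq pq.
  by rewrite /comm_elt mul1g !mulgVK.
rewrite eE comm_eltMr (comm_el (r * g) r pq qk pk) -mulgA; apply: (DM); first exact: Dy.
have -> : (y * el p k (r * g * r) * y^-1 / el p k (r * g * r))%g =
  comm_elt y (el p k (r * g * r)) by [].
rewrite comm_el //; apply: (level_el (gD := gD)) => //.
have -> : - C k p * (r * g * r) = - (r * (C k p * g) * r) by rewrite mulNr !mulrA rC.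
by apply: idealN; apply: levelMr; apply: levelMl; apply: Dg.
Qed.

End Tau.

Lemma mx_in_diff n (A : pzRingType) (I : ideal A) (M : 'M[A]_n) i j :
  mx_in I (M - 1) -> i != j -> I (M i j).
Proof. by move=> IM ij; have := IM i j; rewrite !mxE (negPf ij) mulr0n subr0. Qed.

Lemma mx_in_diag n (A : pzRingType) (I : ideal A) (M : 'M[A]_n) i :
  mx_in I (M - 1) -> I (M i i - 1).
Proof. by move=> IM; have := IM i i; rewrite !mxE eqxx mulr1n. Qed.

(** * Conjugates of elementary matrices modulo a subgroup *)

Section CommutatorFormula.
Variables (n : nat) (A : pzRingType) (hn : (3 <= n)%N).
Local Notation GL := (GL n A).
Local Notation EA := (E n (setT : set A)).
Variables (I J : ideal A) (D : set GL) (gD : is_subgroup D) (nD : normalizes EA D).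
Hypothesis DIJ : forall a b, I a -> J b -> level gD (a * b) /\ level gD (b * a).
Hypothesis Dy : forall k l a b, k != l -> I a -> J b ->
  D (comm_elt (el k l a) (el l k b)).

Lemma conj_el_mod z p j a W r : congGL n J z -> p != j -> I a ->
  (forall c, r * c = c * r) -> uval z p p * W = r -> W * uval z p p = r ->
  D (z * el p j (r * a * r) * z^-1 * (el p j (r * a * r))^-1)%g.
Proof.
move=> Jz pj Ia rC xW Wx; have [_ DM DV] := gD.
have jp : j != p by rewrite eq_sym.
set x := uval z p p in xW Wx *; set Z := uval z; set h := uinv z.
have JZ : mx_in J (Z - 1) by apply/congGL_mx.
have Jh : mx_in J (h - 1) by apply: congGL_inv_mx.
pose P : 'M[A]_n := smx p p 1; pose rho : 'M[A]_n := r%:M.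
have [C CE] : exists C, C = Z * smx p p W by eexists.
have rhoC M : rho * M = M * rho by apply: scalar_mx_central.
have CP : C * P = C by rewrite CE -mulrA smxM mulr1.
have PC : P * C = rho * P.
  rewrite CE scalar_mxM_smx mulr1 mulrA; apply/matrixP => k l.
  by rewrite mul_smxE smx_mulE mxE; case: (l == p); case: (k == p);
    rewrite ?mul1r ?mul0r.
pose V0 := smx p j (x * a) * h.
have [V VE] : exists V, V = V0 - V0 * P by eexists.
have VEkl k l : V k l = if (k == p) && (l != p) then x * a * h j l else 0.
  rewrite VE mxE [X in _ + X]mxE mul_smxE !smx_mulE mulr1.
  by have [->|_] := eqVneq l p; case: (k == p); rewrite ?subrr ?subr0.
(* Column [p] of [Z] times row [j] of [h]. As [h * Z = 1], the row annihilates [C], so [rho] to its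
   right may become [rho - C]; and [P * (rho - C) = 0] lets its entry at [p] be dropped. Of the two
   factors [r], one is [W * x] and the other is [rho]. *)
have zE : Z * smx p j (r * a * r) * h = C * V * (rho - C).
  have Pann : P * (rho - C) = 0 by rewrite mulrBr PC rhoC subrr.
  have V0C : V0 * C = 0.
    by rewrite /V0 CE -mulrA (mulrA h) uinvK mul1r smxM0.
  rewrite VE -[RHS]mulrA [(V0 - _) * _]mulrBl -(mulrA V0 P) Pann mulr0 subr0.
  rewrite [V0 * _]mulrBr V0C subr0 -(rhoC V0) /V0 CE -[RHS]mulrA (mulrA rho).
  rewrite scalar_mxM_smx (mulrA (smx p p W)) smxM -mulrA; congr (_ * (smx _ _ _ * _)).
  by rewrite mulrA -(rC W) -!mulrA (mulrA W) Wx -(rC a).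
have PV : P * V = V.
  apply/matrixP => k l; rewrite smx_mulE !VEkl eqxx mul1r.
  by case: (k == p).
have VP : V * P = 0.
  apply/matrixP => k l; rewrite mul_smxE !VEkl eqxx andbF mul0r if_same.
  by rewrite mxE.
(* The entry of [V] at [j]. It agrees with [a] modulo the level of [D], because [x] and [h j j] are
   1 modulo [J]; the other entries lie in that level. *)
pose g := x * a * h j j.
have VD : V = smx p j g + (V - smx p j g) by rewrite addrC subrK.
set e := el p j (r * a * r); rewrite unipJ ?smx_sq // -/Z -/h zE VD (tauD rC CP PC).
pose e' := el p j (r * g * r).
set u := unip _; set u' := unip _.
have -> : (u * u' * e^-1 = (u * e'^-1) * (e' * u' * e'^-1) * (e' * e^-1))%g.
  by rewrite !mulgA !mulgVK.
have Ee' : EA e' by apply: E_el.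
apply: (DM); first apply: (DM).
- apply: (tau_mod hn nD) => //.
  + move=> l lp; rewrite CE mul_smxE eqxx /g !mulrA; apply: levelMr.
    have Jl : J (Z l p * W * x) by do 2!apply: idealMr; apply: mx_in_diff.
    by case: (DIJ Ia Jl).
  + move=> q qp; apply: Dy => //; first by rewrite eq_sym.
      by rewrite /g; apply: idealMl; apply: idealMr; apply: idealMl.
    by apply: idealN; rewrite CE mul_smxE eqxx; apply: idealMr; apply: mx_in_diff.
- apply: nD => //; apply: (tau_level hn nD rC CP PC).
  + move=> k l; rewrite !mxE VEkl; case: (k =P p) => _; last first.
      by rewrite subr0; exact: (ideal0 (level gD)).
    have [->|lp] := eqVneq l p; first by rewrite /= (negPf pj) subr0; exact: (ideal0 (level gD)).
    have [->|lj] := eqVneq l j; first by rewrite /= ?jp subrr; exact: (ideal0 (level gD)).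
    rewrite /= subr0 -mulrA; apply: levelMl.
    by case: (DIJ Ia (mx_in_diff Jh (_ : j != l))) => //; rewrite eq_sym.
  + by rewrite mulrBr PV smxM mul1r.
  + by rewrite mulrBl VP smxM0 // subr0.
- rewrite /e' /e -elN // -elD //; apply: (level_el (gD := gD)) => //.
  have -> : r * g * r - r * a * r = r * (g - a) * r by rewrite mulrBr mulrBl.
  apply: levelMr; apply: levelMl.
  have -> : g - a = (x - 1) * a * h j j + a * (h j j - 1).
    by rewrite /g mulrBr mulr1 !mulrBl mul1r addrA subrK.
  apply: (idealD (I := level gD)); last by case: (DIJ Ia (mx_in_diag j Jh)).
  by apply: levelMr; case: (DIJ Ia (mx_in_diag p JZ)).
Qed.

End CommutatorFormula.

(** * Local-global principle for commutators *)

Section QuasiFinite.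
Variables (n : nat) (hn : (3 <= n)%N) (R : comPzRingType) (A : pzRingType).
Variables (phi : {rmorphism R -> A}).
Hypotheses (phiC : central_morphism phi) (A_qf : quasi_finite phi).
Local Notation GL := (GL n A).
Local Notation EA := (E n (setT : set A)).

(** As [h * Z = 1], the element [1 - h p p * Z p p] is the sum of the [h p k * Z k p] with [k != p].
    Adding [d] times it to the [(p, p)] entry is therefore a row operation with coefficients
    [d * h p k], which lie in [J]; being supported in row [p], it commutes with every [e_pj]. *)
Lemma local_unit_entry (J : ideal A) (m : ideal R) (g : GL) p :
  congGL n J g -> maximal_ideal m ->
  exists eps W r, [/\ relE n J eps,
    forall j a, p != j -> comm_elt (el p j a) eps = 1%g,
    ~ m r, uval (eps * g)%g p p * W = phi r & W * uval (eps * g)%g p p = phi r].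
Proof.
move=> Jg mmax; set Z := uval g; set h := uinv g.
have Jh : mx_in J (h - 1) by apply: congGL_inv_mx.
have [d [W [r [mr xW Wx]]]] := quasi_finite_unit (Z p p) (h p p) phiC A_qf mmax.
pose S := pred1 p; pose V := smx p p d * h - smx p p (d * h p p).
have VE k l : V k l = if (k == p) && (l != p) then d * h p l else 0.
  rewrite mxE smx_mulE [X in _ + X]mxE mxE.
  by have [->|_] := eqVneq l p; case: (k == p); rewrite ?subrr ?subr0.
have bV : block S V by move=> k l; rewrite VE /= => /negPf->.
exists (unip V), W, r.
have -> : uval (unip V * g)%g p p = Z p p + d * (1 - h p p * Z p p).
  rewrite uvalM uval_unip ?(block_mul bV bV) // mulrDl mul1r mxE; congr (_ + _).
  rewrite mulrBl -mulrA uinvK mulr1 mxE [X in _ + X]mxE smx_mulE mxE !eqxx.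
  by rewrite mulrBr mulr1 mulrA.
split=> //.
  apply: (unip_block_mem _ bV); first exact: relE_group.
  move=> k l /eqP-> lp; rewrite VE eqxx lp; apply: relE_el; first by rewrite eq_sym.
  by apply: idealMl; apply: mx_in_diff; rewrite // eq_sym.
move=> j a pj; have bs : block S (smx p j a) by apply: block_smx; rewrite //= eq_sym.
have bM := block_mul bs bV; have bM' := block_mul bV bs.
have [s0 V0] := (block_mul bs bs, block_mul bV bV).
by apply: comm_elt_eq1; rewrite /el -unipD // -unipD // addrC.
Qed.

(** [D] is a parameter because it will be [relE], then [commE], and finally the group of elements
    commuting with a congruence subgroup modulo a normal subgroup. *)
Theorem comm_relE_congGL (I J : ideal A) (D : set GL) (gD : is_subgroup D) :
  normalizes EA D ->
  (forall a b, I a -> J b -> level gD (a * b) /\ level gD (b * a)) ->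
  (forall k l a b, k != l -> I a -> J b -> D (comm_elt (el k l a) (el l k b))) ->
  forall x z, relE n I x -> congGL n J z -> D (comm_elt x z).
Proof.
move=> nD DIJ Dy; have [D1 DM DV] := gD.
have nDV g y : EA g -> D (g * y * g^-1)%g -> D y.
  move=> Eg Dg; have [_ _ EV] := E_group n (setT : set A).
  by have := nD _ _ (EV _ Eg) Dg; rewrite !mulgA mulVg mul1g invgK mulgVK.
have base p j a z : p != j -> I a -> congGL n J z -> D (comm_elt (el p j a) z).
  move=> pj Ia Jz.
  pose q r := forall s, D (comm_elt (el p j (phi (s * r) * a)) z).
  have q0 : q 0 by move=> s; rewrite mulr0 rmorph0 mul0r el0 comm_1elt.
  have qB r s : q r -> q s -> q (r - s).
    move=> qr qs t; rewrite mulrBr rmorphB mulrBl elD // comm_eltMl.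
    apply: (DM); first by apply: nD; [apply: E_el | rewrite -mulNr -rmorphN -mulNr; apply: qs].
    exact: qr.
  have qMl c r : q r -> q (c * r) by move=> qr s; rewrite mulrA; apply: qr.
  have qMr c r : q r -> q (r * c) by rewrite mulrC; apply: qMl.
  pose Q := Ideal q0 qB qMl qMr.
  suff : Q 1 by move/(_ 1); rewrite mulr1 rmorph1 mul1r.
  apply: contrapT => /exists_maximal_ideal[m [mmax Qm]].
  have [eps [W [r [Reps ceps mr xW Wx]]]] := local_unit_entry p Jz mmax.
  (* The square appears because [conj_el_mod] needs a factor [r] on either side of the entry. *)
  apply: (maximal_ideal_prime mmax mr mr); apply: Qm => s /=.
  have rC c : phi r * c = c * phi r by [].
  have Eeps := relE_EA Reps.
  have [_ JM _] := congGL_group n J.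
  have Jez : congGL n J (eps * z)%g by apply: (JM) => //; apply: relE_congGL.
  have Isa : I (phi s * a) by apply: idealMl.
  have := conj_el_mod hn nD DIJ Dy Jez pj Isa rC xW Wx.
  have -> : phi r * (phi s * a) * phi r = phi (s * (r * r)) * a.
    by rewrite -(phiC r) !mulrA -!rmorphM mulrC mulrA.
  set e := el p j _ => De.
  (* Since [eps] commutes with [e], the commutator of [e] with [eps * z] is the conjugate by [eps]
     of the one with [z]. *)
  have : D (comm_elt (eps * z)%g e) by [].
  move/DV; rewrite comm_eltV comm_eltMr ceps // mul1g.
  exact: nDV.
move=> x z Rx; have Ex := relE_EA Rx.
pose H := [set x | EA x /\ forall z, congGL n J z -> D (comm_elt x z)].
suff HR : relE n I `<=` H by move=> Jz; have [_] := HR _ Rx; apply.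
have [E1 EM EV] := E_group n (setT : set A).
apply: relE_min => [|g y Eg [Ey Hy]|i j a ij Ia]; last 2 first.
- split=> [|w Jw]; first by apply: (EM); [apply: (EM)|apply: EV].
  by rewrite -(conjVK g w) -comm_eltJ; apply: nD => //; apply: Hy; apply: congGL_normal.
- by split; [apply: E_el | move=> w Jw; apply: base].
split=> [|y w [Ey Hy] [Ew Hw]|y [Ey Hy]].
- by split=> // w Jw; rewrite comm_1elt.
- split=> [|v Jv]; first exact: EM.
  by rewrite comm_eltMl; apply: (DM); [apply: nD => //; apply: Hw | apply: Hy].
- split=> [|v Jv]; first exact: EV.
  apply: (nDV y) => //.
  have -> : (y * comm_elt y^-1 v * y^-1 = (comm_elt y v)^-1)%g.
    by rewrite comm_eltV /comm_elt invgK !mulgA mulgV mul1g.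
  by apply: DV; apply: Hy.
Qed.

End QuasiFinite.

(** * The ideal [I J + J I] and commutators of relative elementary groups *)

Section SymmetricProduct.
Variables (A : pzRingType) (I J : ideal A).

(** [I J + J I] as the intersection of all ideals containing the products, so that inclusions are
    checked on products alone. *)
Definition symm_prod_set : set A :=
  [set x | forall L : ideal A,
     (forall a b, I a -> J b -> L (a * b) /\ L (b * a)) -> L x].

Lemma symm_prod0 : symm_prod_set 0.
Proof. by move=> L _; apply: ideal0. Qed.
Lemma symm_prodB x y : symm_prod_set x -> symm_prod_set y -> symm_prod_set (x - y).
Proof. by move=> Lx Ly L LIJ; apply: idealB; [apply: Lx | apply: Ly]. Qed.
Lemma symm_prodMl a x : symm_prod_set x -> symm_prod_set (a * x).
Proof. by move=> Lx L LIJ; apply: idealMl; apply: Lx. Qed.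
Lemma symm_prodMr a x : symm_prod_set x -> symm_prod_set (x * a).
Proof. by move=> Lx L LIJ; apply: idealMr; apply: Lx. Qed.

Definition symm_prod : ideal A := Ideal symm_prod0 symm_prodB symm_prodMl symm_prodMr.

Lemma symm_prodP a b : I a -> J b -> symm_prod (a * b) /\ symm_prod (b * a).
Proof. by move=> Ia Jb; split=> L LIJ; have [] := LIJ _ _ Ia Jb. Qed.

Lemma symm_prod_min (L : ideal A) x :
  (forall a b, I a -> J b -> L (a * b) /\ L (b * a)) -> symm_prod x -> L x.
Proof. by move=> LIJ; apply. Qed.

End SymmetricProduct.

Section ElementaryCommutators.
Variables (n : nat) (A : pzRingType) (hn : (3 <= n)%N).
Local Notation GL := (GL n A).
Local Notation EA := (E n (setT : set A)).
Local Notation relE := (relE n).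
Local Notation congGL := (congGL n).
Implicit Types (I J K : ideal A).

Definition commE I J : set GL := comm_subgroup (relE I) (relE J).

Lemma commE_group I J : is_subgroup (commE I J).
Proof. exact: comm_subgroup_group. Qed.

Lemma commE_normalEA I J : normalizes EA (commE I J).
Proof.
have nc g : EA g -> forall x, commE I J x -> commE I J (g * x * g^-1)%g.
  move=> Eg.
  pose H := [set x | commE I J (g * x * g^-1)%g].
  suff : commE I J `<=` H by [].
  have [H1 HM HV] := commE_group I J.
  apply: comm_subgroup_min => [|x y Ix Jy]; last first.
    by rewrite /H /= comm_eltJ; apply: mem_comm_subgroup; apply: relE_normal.
  split=> [|x y Hx Hy|x Hx]; rewrite /H /=.
  - by rewrite mulg1 mulgV.
  - have -> : (g * (x * y) * g^-1 = (g * x * g^-1) * (g * y * g^-1))%g.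
      by rewrite !mulgA mulgVK.
    exact: HM.
  - have -> : (g * x^-1 * g^-1 = (g * x * g^-1)^-1)%g by rewrite !invgM invgK mulgA.
    exact: HV.
by move=> g x Eg; apply: nc.
Qed.

Lemma relE_level I a : I a -> level (relE_group n I) a.
Proof. by move=> Ia k l x y kl; apply: relE_el => //; apply: idealMr; apply: idealMl. Qed.

Lemma commE_level I J a b : I a -> J b ->
  level (commE_group I J) (a * b) /\ level (commE_group I J) (b * a).
Proof.
move=> Ia Jb; split=> k l x y kl; have [p [pk pl]] := third_index k l hn.
- have -> : x * (a * b) * y = (x * a) * (b * y) by rewrite !mulrA.
  rewrite -(@comm_el _ _ k p l) // 1?eq_sym //.
  apply: mem_comm_subgroup; apply: relE_el; rewrite // 1?eq_sym //.
    exact: idealMl.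
  exact: idealMr.
- have -> : x * (b * a) * y = (x * b) * (a * y) by rewrite !mulrA.
  rewrite -(@comm_el _ _ k p l) // 1?eq_sym //.
  rewrite -comm_eltV; have [_ _ HV] := commE_group I J; apply: HV.
  apply: mem_comm_subgroup; apply: relE_el; rewrite // 1?eq_sym //.
    exact: idealMr.
  exact: idealMl.
Qed.

Lemma commE_symm_prod_level I J a : symm_prod I J a -> level (commE_group I J) a.
Proof. by apply: symm_prod_min => b c Ib Jc; apply: commE_level. Qed.

Lemma relE_symm_prod_sub I J : relE (symm_prod I J) `<=` commE I J.
Proof.
apply: relE_min => [||i j a ij Qa]; [exact: commE_group | exact: commE_normalEA|].
by apply: (level_el (gD := commE_group I J)) => //; apply: commE_symm_prod_level.
Qed.

Lemma comm_congGL I J x z : congGL I x -> congGL J z ->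
  congGL (symm_prod I J) (comm_elt x z).
Proof.
move=> /congGL_mx Ix /congGL_mx Jz; apply/congGL_mx.
rewrite /comm_elt !uvalM !uvalV; set X := uval x in Ix *; set Z := uval z in Jz *.
have -> : X * Z * uinv x * uinv z - 1 =
    ((X - 1) * (Z - 1) - (Z - 1) * (X - 1)) * uinv x * uinv z.
  have -> : (X - 1) * (Z - 1) - (Z - 1) * (X - 1) = X * Z - Z * X.
    have e (M N : 'M[A]_n) : (M - 1) * (N - 1) = M * N - (M + N - 1).
      by rewrite mulrBl mul1r mulrBr mulr1 !opprB !opprD !addrA [_ - M + 1]addrAC.
    by rewrite !e subrBACA [Z + X]addrC subrr subr0.
  by rewrite !mulrBl -(mulrA Z X) uvalK mulr1 uvalK.
apply: mx_inMr; apply: mx_inMr; apply: mx_inB.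
- by apply: (mx_in_mul _ Ix Jz) => a b Ia Jb; case: (symm_prodP Ia Jb).
- by apply: (mx_in_mul _ Jz Ix) => b a Jb Ia; case: (symm_prodP Ia Jb).
Qed.

Lemma commE_congGL I J : commE I J `<=` congGL (symm_prod I J).
Proof.
apply: comm_subgroup_min => [|x y Ix Jy]; first exact: congGL_group.
by apply: comm_congGL; apply: relE_congGL.
Qed.

End ElementaryCommutators.

(** * Normality and double commutators over quasi-finite algebras *)

Section QuasiFiniteCommutators.
Variables (n : nat) (hn : (3 <= n)%N) (R : comPzRingType) (A : pzRingType).
Variables (phi : {rmorphism R -> A}).
Hypotheses (phiC : central_morphism phi) (A_qf : quasi_finite phi).
Local Notation GL := (GL n A).
Local Notation EA := (E n (setT : set A)).
Local Notation relE := (relE n).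
Local Notation congGL := (congGL n).
Local Notation commE := (@commE n A).
Implicit Types (I J K : ideal A).

(** The case [J = A], [D = E(A, I)] of the local-global principle. *)
Lemma relE_normalGL I : normalizes setT (relE I).
Proof.
move=> z x _ Ix; have gI := relE_group n I; have [_ IM IV] := gI.
have -> : (z * x * z^-1 = (comm_elt x z)^-1 * x)%g by rewrite comm_eltV /comm_elt mulgVK.
apply: (IM) => //; apply: IV.
apply: (comm_relE_congGL hn phiC A_qf (gD := gI) (@relE_normal _ _ I) _ _ Ix (congGLT z)).
  by move=> a b Ia _; split; apply: relE_level; [apply: idealMr | apply: idealMl].
move=> k l a b kl Ia _; apply: (comm_mem gI (@relE_normal _ _ I)); first exact: relE_el.
by apply: E_el; rewrite // eq_sym.
Qed.

(** The case [I = A], [D = E(A, J)] of the same principle. *)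
Lemma comm_EA_congGL J x z : EA x -> congGL J z -> relE J (comm_elt x z).
Proof.
move=> Ex Jz; have gJ := relE_group n J; have [_ _ JV] := gJ.
apply: (comm_relE_congGL hn phiC A_qf (gD := gJ) (@relE_normal _ _ J) _ _ (EA_relE Ex) Jz).
  by move=> a b _ Jb; split; apply: relE_level; [apply: idealMl | apply: idealMr].
move=> k l a b kl _ Jb; rewrite -comm_eltV; apply: JV.
apply: (comm_mem gJ (@relE_normal _ _ J)); last exact: E_el.
by apply: relE_el; rewrite // eq_sym.
Qed.

Lemma comm_congGL_EA J z x : congGL J z -> EA x -> relE J (comm_elt z x).
Proof.
move=> Jz Ex; rewrite -comm_eltV; have [_ _ JV] := relE_group n J.
by apply: JV; apply: comm_EA_congGL.
Qed.

Lemma comm_relE_congGL_commE I J x z : relE I x -> congGL J z -> commE I J (comm_elt x z).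
Proof.
apply: (comm_relE_congGL hn phiC A_qf (gD := commE_group n I J)) => [|a b|k l a b kl Ia Jb].
- exact: commE_normalEA.
- exact: commE_level.
- by apply: mem_comm_subgroup; apply: relE_el; rewrite // eq_sym.
Qed.

Lemma commE_normalGL I J : normalizes setT (commE I J).
Proof. by apply: comm_subgroup_normal; apply: relE_normalGL. Qed.

(* Three-subgroup argument: e_ij(k) = [e_ip(1), e_pj(k)], and h commutes with
   e_ip(1) modulo E(A, Q) and with e_pj(k) modulo GL(A, QK + KQ). *)
Lemma comm_commE_relE I J K h k : commE I J h -> relE K k ->
  commE (symm_prod I J) K (comm_elt h k).
Proof.
set Q := symm_prod I J; set NN := commE Q K.
have gN : is_subgroup NN := commE_group n Q K.
have nN : normalizes setT NN := @commE_normalGL Q K.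
move=> Hh Kk; have [N1 NM NV] := gN.
pose Z := [set k | relE K k /\ forall h, commE I J h -> NN (comm_elt h k)].
suff : relE K `<=` Z by move=> /(_ k Kk)[_]; apply.
have [K1 KM KV] := relE_group n K.
move=> {h k Hh Kk}; apply: relE_min => [|g k Eg [Kk Zk]|i j a ij Ka].
- split=> [|x y [Kx Zx] [Ky Zy]|x [Kx Zx]].
  + by split=> // h _; rewrite comm_elt1.
  + split=> [|h Hh]; first exact: KM.
    by rewrite comm_eltMr; apply: (NM); [apply: Zx | apply: nN => //; apply: Zy].
  + split=> [|h Hh]; first exact: KV.
    by rewrite comm_eltVr; apply: nN => //; apply: (NV); apply: Zx.
- split=> [|h Hh]; first exact: relE_normal.
  by rewrite -(conjVK g h) -comm_eltJ; apply: nN => //; apply: Zk; apply: commE_normalGL.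
split=> [|h Hh]; first exact: relE_el.
have [p [pi pj]] := third_index i j hn.
have ip : i != p by rewrite eq_sym.
pose u : GL := el i p 1; pose v : GL := el p j a.
have uv : el i j a = comm_elt u v by rewrite /u /v comm_el // mul1r.
have Eu : EA u by apply: E_el.
have Kv : relE K v by apply: relE_el.
pose f := comm_elt h u; pose t := comm_elt h v.
have Qh : congGL Q h by apply: commE_congGL.
have Qf : relE Q f by apply: comm_congGL_EA.
have QKt : congGL (symm_prod Q K) t by apply: comm_congGL => //; apply: relE_congGL.
have tN x : EA x -> NN (comm_elt x t).
  by move=> Ex; apply: (relE_symm_prod_sub hn); apply: comm_EA_congGL.
have [G [q [qM q1]]] := quotient_group gN nN.
apply/q1; rewrite /comm_elt qM (morphV qM).
suff -> : q (h * el i j a * h^-1)%g = q (el i j a) by rewrite mulgV.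
rewrite uv comm_eltJ.
have -> : (h * u * h^-1 = f * u)%g by rewrite /f /comm_elt mulgVK.
have -> : (h * v * h^-1 = t * v)%g by rewrite /t /comm_elt mulgVK.
clearbody f t.
rewrite comm_eltMl [comm_elt u (t * v)]comm_eltMr [comm_elt f (t * v)]comm_eltMr.
have e x y : NN (comm_elt x y) -> (q x * q y = q y * q x)%g.
  by move/q1; rewrite (morph_comm qM) /comm_elt => /(congr1 (fun z => z * q y * q x)%g);
    rewrite !mulgVK mul1g.
have : q (comm_elt u t) = 1%g by apply/q1; apply: tN.
have : q (comm_elt f t) = 1%g by apply/q1; apply: tN; apply: relE_EA Qf.
have : q (comm_elt f v) = 1%g by apply/q1; apply: mem_comm_subgroup.
have Kuv : relE K (comm_elt u v) by rewrite -uv; apply: relE_el.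
have := e _ _ (tN _ (relE_EA Kuv)).
have := e f (comm_elt u v) (mem_comm_subgroup Qf Kuv).
move: (comm_elt u t) (comm_elt f t) (comm_elt f v) (comm_elt u v) => ut ft fv c.
move=> fc ct fv1 ft1 ut1.
rewrite !qM !(morphV qM) fv1 ft1 ut1 !mulg1 !mul1g mulgV mulg1.
by rewrite -ct mulgK fc mulgK.
Qed.

End QuasiFiniteCommutators.

(** * Triple commutators modulo [[E(A, Q), E(A, K)]] *)

Section TripleCommutators.
Variables (n : nat) (hn : (3 <= n)%N) (R : comPzRingType) (A : pzRingType).
Variables (phi : {rmorphism R -> A}).
Hypotheses (phiC : central_morphism phi) (A_qf : quasi_finite phi).
Local Notation GL := (GL n A).
Local Notation EA := (E n (setT : set A)).
Local Notation relE := (relE n).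
Local Notation congGL := (congGL n).
Local Notation commE := (@commE n A).
Variables (I J K : ideal A).
Local Notation Q := (symm_prod I J).
Local Notation NN := (commE Q K).
Local Notation H := (commE I J).
Variables (G : groupType) (pi : GL -> G).
Hypotheses (piM : forall x y, pi (x * y)%g = (pi x * pi y)%g).
Hypotheses (pi1 : forall x, pi x = 1%g <-> NN x).
Implicit Types (i j k l p : 'I_n) (a b c : A) (M : 'M[A]_n).

Lemma pi_conjK h g : H h -> relE K g -> pi (g * h * g^-1)%g = pi h.
Proof.
move=> Hh Kg; have : pi (comm_elt h g) = 1%g.
  by apply/pi1; apply: (comm_commE_relE hn phiC A_qf).
rewrite -comm_eltV (morphV piM) => /(congr1 (fun t => t^-1 * pi h)%g).
by rewrite invgK invg1 mul1g -piM /comm_elt mulgVK.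
Qed.

Lemma pi_commK h g : H h -> relE K g -> (pi g * pi h = pi h * pi g)%g.
Proof.
move=> Hh Kg; have := pi_conjK Hh Kg; rewrite !piM (morphV piM).
by move=> /(congr1 (fun t => t * pi g)%g); rewrite mulgVK.
Qed.

Lemma commH x z : relE I x -> relE J z -> H (comm_elt x z).
Proof. exact: mem_comm_subgroup. Qed.

Lemma commK_l x z : relE K x -> relE K (comm_elt x z).
Proof.
move=> Kx; have [_ KM KV] := relE_group n K; rewrite /comm_elt -!mulgA.
by apply: (KM) => //; rewrite mulgA; apply: (relE_normalGL hn phiC A_qf) => //; apply: KV.
Qed.

Lemma commK_r x z : relE K z -> relE K (comm_elt x z).
Proof.
have [_ _ KV] := relE_group n K.
by move=> Kz; rewrite -comm_eltV; apply: (KV); apply: commK_l.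
Qed.

(** Commutators become multiplicative modulo [N] once the conjugating factor lies in [E(A, K)],
    which acts trivially on [H] modulo [N]. *)
Lemma pi_comm_splitl x' x z : relE K x' -> relE I x -> relE J z ->
  pi (comm_elt (x' * x) z) = (pi (comm_elt x z) * pi (comm_elt x' z))%g.
Proof. by move=> Kx' Ix Jz; rewrite comm_eltMl piM pi_conjK //; apply: commH. Qed.

Lemma pi_comm_splitr x z' z : relE K z' -> relE I x -> relE J z ->
  pi (comm_elt x (z' * z)) = (pi (comm_elt x z') * pi (comm_elt x z))%g.
Proof. by move=> Kz' Ix Jz; rewrite comm_eltMr piM pi_conjK //; apply: commH. Qed.

Lemma NN_level c : level (commE_group n Q K) c -> forall k l, k != l ->
  pi (el k l c) = 1%g.
Proof. by move=> Lc k l kl; apply/pi1; apply: (level_el (gD := commE_group n Q K)). Qed.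

(* The values of y for which [e_kp(a), e_pk(y)] is insensitive to k. *)
Definition loose a y : Prop := [/\ J y, K y & level (commE_group n Q K) (a * y)].

Lemma loose0 a : loose a 0.
Proof. by split; rewrite ?mulr0; apply: ideal0. Qed.

Lemma looseD a x y : loose a x -> loose a y -> loose a (x + y).
Proof.
by move=> [Jx Kx Lx] [Jy Ky Ly]; split; rewrite ?mulrDr; apply: idealD.
Qed.

Lemma looseM a y c : loose a y -> loose a (y * c).
Proof. by move=> [Jy Ky Ly]; split; rewrite ?mulrA; apply: idealMr. Qed.

Lemma loose_mul a b c : I a -> J b -> K c -> loose a (b * c).
Proof.
move=> Ia Jb Kc; split; [exact: idealMr | exact: idealMl | rewrite mulrA].
have [ab _] := symm_prodP Ia Jb.
by have [] := commE_level hn ab Kc.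
Qed.

Definition theta p k x y : G := pi (comm_elt (el k p x) (el p k y)).

Lemma thetaD p k a x y : k != p -> I a -> loose a x -> loose a y ->
  theta p k a (x + y) = (theta p k a x * theta p k a y)%g.
Proof.
move=> kp Ia [Jx Kx _] [Jy Ky _]; rewrite /theta elD; last by rewrite eq_sym.
by apply: pi_comm_splitr; apply: relE_el; rewrite // eq_sym.
Qed.

Lemma theta0 p k a : theta p k a 0 = 1%g.
Proof. by rewrite /theta el0 comm_elt1 (morph1 piM). Qed.

Lemma thetaN p k a y : k != p -> I a -> loose a y ->
  theta p k a (- y) = (theta p k a y)^-1%g.
Proof.
move=> kp Ia Ly; apply: (mulgI (theta p k a y)); rewrite mulgV -thetaD //.
  by rewrite subrr theta0.
by rewrite -mulrN1; apply: looseM.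
Qed.

(** This is [[e_lp(a), e_pk(b)] = e_lk(a b)] conjugated by [e_kl(c)]. Expanding the left side
    relates [[e_kp(c a), e_pk(b)]] to [[e_lp(a), e_pl(- b c)]]: the factor [c] changes sides while
    the index changes. *)
Lemma el_conj_comm p k l a b c : k != l -> k != p -> l != p ->
  comm_elt (el k p (c * a) * el l p a)%g (el p l (- (b * c)) * el p k b)%g =
  (el k l c * el l k (a * b) * (el k l c)^-1)%g.
Proof.
move=> kl kp lp; rewrite -(@comm_el _ _ l p k) // 1?eq_sym // comm_eltJ.
have -> : (el k l c * el l p a * (el k l c)^-1 = el k p (c * a) * el l p a)%g.
  by rewrite -(@comm_el _ _ k l p) // /comm_elt mulgVK.
have -> // : (el k l c * el p k b * (el k l c)^-1 = el p l (- (b * c)) * el p k b)%g.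
rewrite elN 1?eq_sym // -(@comm_el _ _ p k l) // 1?eq_sym // comm_eltV.
by rewrite /comm_elt mulgVK.
Qed.

(** For [c] in [K] the conjugation in [el_conj_comm] is trivial modulo [N]. The term [e_lk(a * b)]
    then cancels from both sides, leaving [theta p k (c * a) b] against
    [theta p l a (- (b * c))]. *)
Lemma theta_swap p k l a b c : k != l -> k != p -> l != p -> I a -> J b -> K c ->
  theta p k (c * a) b = theta p l a (b * c).
Proof.
move=> kl kp lp Ia Jb Kc; have pk : p != k by rewrite eq_sym.
have pl : p != l by rewrite eq_sym.
have lk : l != k by rewrite eq_sym.
have Lbc : loose a (b * c) by apply: loose_mul.
have Hab : H (el l k (a * b)).
  by apply: (level_el (gD := commE_group n I J)) => //; case: (commE_level hn Ia Jb).
have := congr1 pi (el_conj_comm a b c kl kp lp).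
rewrite pi_conjK //; last exact: relE_el.
have Kca : K (c * a) by apply: idealMr.
have Kbc : K (- (b * c)) by apply/idealN/idealMl.
have Ica : I (c * a) by apply: idealMl.
have Jbc : J (- (b * c)) by apply/idealN/idealMr.
have [_ IM _] := relE_group n I.
rewrite pi_comm_splitr; [|exact: relE_el|by apply: (IM); apply: relE_el|exact: relE_el].
have Kx := relE_el kp Kca; have Ix := relE_el lp Ia.
rewrite (pi_comm_splitl Kx Ix (relE_el pl Jbc)) (pi_comm_splitl Kx Ix (relE_el pk Jb)).
rewrite (comm_el (c * a) (- (b * c)) kp pl kl) (comm_el a b lp pk lk).
rewrite (NN_level _ kl) ?mulg1; last first.
  rewrite mulrN; apply: idealN; rewrite -mulrA; apply: idealMl.
  by case: Lbc.
rewrite -/(theta p l a (- (b * c))) -/(theta p k (c * a) b) thetaN // => e.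
apply: (mulgI (theta p l a (b * c))^-1%g).
have Kt : relE K (comm_elt (el l p a) (el p l (b * c))).
  by apply: commK_r; apply: relE_el => //; apply: idealMl.
have := pi_commK Hab Kt; rewrite -/(theta p l a (b * c)) => com.
rewrite mulVg; apply: (mulgI (pi (el l k (a * b)))).
rewrite mulg1 -[in RHS]e !mulgA; congr (_ * _)%g.
apply: (mulgI (theta p l a (b * c))); rewrite !mulgA mulgV mul1g.
by rewrite com mulgK.
Qed.

(** Here [c] is arbitrary, and it is [e_lk(a * y)] itself that is trivial modulo [N]. Taking [c = 1]
    gives independence of the index. *)
Lemma theta_loose_swap p k l a y c : k != l -> k != p -> l != p -> I a -> loose a y ->
  theta p k (c * a) y = theta p l a (y * c).
Proof.
move=> kl kp lp Ia Ly; have [Jy Ky Lay] := Ly; have pk : p != k by rewrite eq_sym.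
have pl : p != l by rewrite eq_sym.
have lk : l != k by rewrite eq_sym.
have Lyc : loose a (y * c) by apply: looseM.
have := congr1 pi (el_conj_comm a y c kl kp lp).
rewrite [in RHS]piM [in RHS]piM (morphV piM) (NN_level Lay lk) mulg1 mulgV.
have Kyc : K (- (y * c)) by apply/idealN/idealMr.
have Ica : I (c * a) by apply: idealMl.
have Jyc : J (- (y * c)) by apply/idealN/idealMr.
have [_ IM _] := relE_group n I.
rewrite pi_comm_splitr; [|exact: relE_el|by apply: (IM); apply: relE_el|exact: relE_el].
have -> : pi (comm_elt (el k p (c * a) * el l p a)%g (el p k y)) = theta p k (c * a) y.
  rewrite comm_eltMl piM -/(theta p k (c * a) y) (comm_el a y lp pk lk).
  rewrite !piM (morphV piM) (NN_level Lay lk) mulg1 mulgV.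
  by rewrite mul1g.
have -> : pi (comm_elt (el k p (c * a) * el l p a)%g (el p l (- (y * c)))) =
    theta p l a (- (y * c)).
  have -> : (el k p (c * a) * el l p a = el l p a * el k p (c * a))%g.
    have /(congr1 (fun t => (t * el l p a * el k p (c * a))%g)) :=
      comm_el1 (c * a) a kp lp pl pk.
    by rewrite /comm_elt mul1g !mulgVK.
  rewrite comm_eltMl piM -/(theta p l a (- (y * c))) (comm_el (c * a) _ kp pl kl).
  rewrite !piM (morphV piM).
  rewrite (NN_level _ kl) ?mulg1 ?mulgV ?mul1g //.
  rewrite mulrN; apply: idealN; rewrite -mulrA; apply: idealMl.
  by case: Lyc.
rewrite thetaN // => e; apply: (mulgI (theta p l a (y * c))^-1%g).
by rewrite e mulVg.
Qed.

Lemma theta_loose p k l a y : k != p -> l != p -> I a -> loose a y ->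
  theta p k a y = theta p l a y.
Proof.
move=> kp lp Ia Ly; have [->//|kl] := eqVneq k l.
by have := theta_loose_swap 1 kl kp lp Ia Ly; rewrite mul1r mulr1.
Qed.

(** * Commutator of a perturbed column with a perturbed row *)

Section Bilinear.
Variables (p i : 'I_n) (a b r : A) (U V : 'M[A]_n).
Hypotheses (ip : i != p) (Ia : I a) (Jb : J b) (rC : forall c, r * c = c * r).
Hypotheses (Up : U p i = 0) (Vp : V i p = 0).
Hypotheses (KU : forall k, K (U k i - (if k == i then r else 0))).
Hypotheses (KV : forall k, K (V i k - (if k == i then 1 else 0))).
Hypothesis VU : \sum_k V i k * U k i = r.

Let kap k := U k i - (if k == i then r else 0).
Let del k := V i k - (if k == i then 1 else 0).

Lemma transvection_split_col : U * smx i p a =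
  \sum_k smx k p (kap k * a) + smx i p (r * a).
Proof.
apply/matrixP => k l; rewrite mul_smxE mxE summxE (bigD1 k) //= big1 => [|m mk].
  rewrite addr0 !mxE eqxx /kap /=.
  by have [->|ki] := eqVneq k i; case: (l == p) => /=;
    rewrite ?mulrBl ?subrK ?mul0r ?subr0 ?addr0.
by rewrite mxE eq_sym (negPf mk).
Qed.

Lemma transvection_split_row : smx p i b * V =
  \sum_k smx p k (b * del k) + smx p i b.
Proof.
apply/matrixP => l k; rewrite smx_mulE mxE summxE (bigD1 k) //= big1 => [|m mk].
  rewrite addr0 !mxE eqxx andbT /del.
  by have [->|ki] := eqVneq k i; case: (l == p) => /=;
    rewrite ?mulrBr ?mulr1 ?subrK ?mulr0 ?subr0 ?addr0.
by rewrite mxE [k == m]eq_sym (negPf mk) andbF.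
Qed.

(** The column and the row differ from [e_ip(r a)] and [e_pi(b)] by the entries [kap] and [del] in
    [K]. Besides the main term, the expansion gives values of [theta] that can all be moved to one
    index [j], where they add up to [theta p j a] at [b] times the sum in [VU] minus [b * r], that
    is, at 0. *)
Lemma pi_comm_transvection :
  pi (comm_elt (unip (U * smx i p a)) (unip (smx p i b * V))) = theta p i (r * a) b.
Proof.
have [j [jp ji]] := third_index p i hn.
have pi' : p != i by rewrite eq_sym.
have ij : i != j by rewrite eq_sym.
have kap_p : kap p = 0 by rewrite /kap Up (negPf pi') subr0.
have del_p : del p = 0 by rewrite /del Vp (negPf pi') subr0.
have Lb k : loose a (b * del k) by apply: loose_mul => //; apply: KV.
pose phi' y := theta p j a y.
have phiD x y : loose a x -> loose a y -> phi' (x + y) = (phi' x * phi' y)%g.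
  exact: thetaD.
pose S := [pred k | k != p]; pose S' := pred1 p.
have [I1 IM _] := relE_group n I; have [J1 JM _] := relE_group n J.
have [K1 KM _] := relE_group n K.
(* Beyond the value of the commutator as [theta p j a y], the clauses carry what makes the assertion
   additive in [M]. *)
pose Pl z M y := [/\ block S M, relE K (unip M), relE I (unip M), loose a y &
  pi (comm_elt (unip M) z) = phi' y].
have Pl0 z : Pl z 0 0.
  split; rewrite ?unip0 //; [exact: block0 | exact: loose0 |].
  by rewrite /phi' theta0 comm_1elt (morph1 piM).
have PlD z M y M' y' : relE J z -> Pl z M y -> Pl z M' y' -> Pl z (M + M') (y + y').
  move=> Jz [bM KM1 IM1 Ly e] [bM' KM' IM' Ly' e'].
  have [MM NN'] := (block_mul bM bM, block_mul bM' bM').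
  have [MN NM] := (block_mul bM bM', block_mul bM' bM).
  split; rewrite ?[unip _]unipD //; [exact: blockD|exact: KM|exact: IM|exact: looseD|].
  by rewrite addrC phiD // -e -e'; apply: pi_comm_splitl.
have single k l c y : K c -> J y -> k != p -> l != p ->
    Pl (el p l y) (smx k p (c * a)) (if k == l then y * c else 0).
  move=> Kc Jy kp lp; have Lyc : loose a (y * c) by apply: loose_mul.
  split.
  - by apply: block_smx; rewrite //= eqxx.
  - by apply: relE_el => //; apply: idealMr.
  - by apply: relE_el => //; apply: idealMl.
  - by case: ifP => // _; apply: loose0.
  have pl : p != l by rewrite eq_sym.
  have [<-|kl] := eqVneq k l; last first.
    rewrite -/(el k p (c * a)) comm_el // /phi' theta0 (NN_level _ kl) // -mulrA.
    by have [ay _] := symm_prodP Ia Jy; have [_] := commE_level hn ay Kc.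
  (* [theta_swap] needs two different indices, so for [k = j] the target is first moved to [i]. *)
  have [->|kj] := eqVneq k j; last exact: theta_swap.
  by rewrite /phi' (theta_loose (l := i) jp ip) //; apply: theta_swap.
pose A1 := \sum_k smx k p (kap k * a).
have A1z l y : J y -> l != p ->
    Pl (el p l y) A1 (\sum_k if k == l then y * kap k else 0).
  move=> Jy lp; have Jz : relE J (el p l y) by apply: relE_el; rewrite // eq_sym.
  apply: (big_ind2 (Pl (el p l y))) => [||k _]; [exact: Pl0 | by move=> *; apply: PlD|].
  have [->|kp] := eqVneq k p; last by apply: single => //; apply: KU.
  rewrite kap_p mul0r smx0 mulr0 if_same; exact: Pl0.
have A1E l y : J y -> l != p ->
    [/\ relE K (unip A1), relE I (unip A1), loose a (y * kap l) &
     pi (comm_elt (unip A1) (el p l y)) = phi' (y * kap l)].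
  move=> Jy lp; have := A1z l y Jy lp.
  by rewrite -big_mkcond big_pred1_eq => -[].
pose x := unip (U * smx i p a).
have [KA1 IA1 Lb0 piA1z0] := A1E i b Jb ip.
have bA1 : block S A1 by have [] := A1z i b Jb ip.
have bs : block S (smx i p (r * a)) by apply: block_smx; rewrite //= eqxx.
have xE : x = (unip A1 * el i p (r * a))%g.
  by rewrite /x transvection_split_col unipD ?(block_mul bA1 bA1, block_mul bs bs,
    block_mul bA1 bs, block_mul bs bA1).
have Ira : I (r * a) by apply: idealMl.
have Ix : relE I x by rewrite xE; apply: (IM) => //; apply: relE_el.
pose y l := (if i == l then b * del l * r else 0) + b * del l * kap l.
pose Pr M t := [/\ block S' M, relE K (unip M), relE J (unip M), loose a t &
  pi (comm_elt x (unip M)) = phi' t].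
have Pr0 : Pr 0 0.
  split; rewrite ?unip0 //; [exact: block0 | exact: loose0 |].
  by rewrite /phi' theta0 comm_elt1 (morph1 piM).
have PrD M t M' t' : Pr M t -> Pr M' t' -> Pr (M + M') (t + t').
  move=> [bM KM1 JM1 Lt e] [bM' KM' JM' Lt' e'].
  have [MM NN'] := (block_mul bM bM, block_mul bM' bM').
  have [MN NM] := (block_mul bM bM', block_mul bM' bM).
  split; rewrite ?[unip _]unipD //; [exact: blockD|exact: KM|exact: JM|exact: looseD|].
  by rewrite phiD // -e -e'; apply: pi_comm_splitr.
have Prl l : Pr (smx p l (b * del l)) (y l).
  have [->|lp] := eqVneq l p.
    by rewrite /y del_p mulr0 !mul0r if_same addr0 smx0.
  have pl : p != l by rewrite eq_sym.
  have [Jbl Kbl Labl] := Lb l.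
  have [_ _ Lk piA1l] := A1E l _ Jbl lp.
  have Ly : loose a (if i == l then b * del l * r else 0).
    by case: ifP => _; [apply: looseM | apply: loose0].
  split; [by apply: block_smx; rewrite //= eqxx | exact: relE_el | exact: relE_el | |].
    exact: looseD.
  rewrite -/(el p l _) xE pi_comm_splitl //; [|exact: relE_el|exact: relE_el].
  rewrite piA1l phiD //; congr (_ * _)%g.
  have [<-|il] := eqVneq i l; first exact: theta_loose_swap.
  rewrite comm_el // /phi' theta0 (NN_level _ il) // -mulrA.
  exact: idealMl.
pose B1 := \sum_l smx p l (b * del l).
have [bB1 KB1 JB1 LB1 piB1] : Pr B1 (\sum_l y l).
  by apply: (big_ind2 Pr).
have bz : block S' (smx p i b) by apply: block_smx; rewrite //= eqxx.
have zE : unip (smx p i b * V) = (unip B1 * el p i b)%g.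
  by rewrite transvection_split_row unipD ?(block_mul bB1 bB1, block_mul bz bz,
    block_mul bB1 bz, block_mul bz bB1).
have Jz : relE J (el p i b) by apply: relE_el.
have Ii : relE I (el i p (r * a)) by apply: relE_el.
rewrite -/x zE pi_comm_splitr // piB1 xE pi_comm_splitl //.
rewrite piA1z0 -/(theta p i (r * a) b) mulgA.
have -> : (phi' (\sum_l y l) * theta p i (r * a) b = theta p i (r * a) b * phi' (\sum_l y l))%g.
  by rewrite -piB1; apply: pi_commK; [apply: commH | apply: commK_r].
rewrite -mulgA -(phiD _ _ LB1 Lb0).
suff -> : \sum_l y l + b * kap i = 0 by rewrite /phi' theta0 mulg1.
rewrite /y big_split /= -big_mkcond /=.
have -> : \sum_(l | i == l) b * del l * r = b * del i * r.
  by under eq_bigl do rewrite eq_sym; rewrite big_pred1_eq.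
have -> : \sum_l b * del l * kap l = b * (r - (V i i * r + U i i - r)).
  under eq_bigr do rewrite -mulrA; rewrite -mulr_sumr; congr (_ * _).
  transitivity (\sum_k (V i k * U k i - (if k == i then V i i * r + U i i - r else 0))).
    apply: eq_bigr => k _; rewrite /del /kap; case: eqP => [->|_]; last by rewrite !subr0.
    by rewrite mulrBl mul1r mulrBr -[V i i * r + _ - _]addrA [in RHS]opprD addrA.
  by rewrite sumrB VU -big_mkcond big_pred1_eq.
rewrite -mulrA -!mulrDr /del /kap !eqxx mulrBl mul1r.
have -> : V i i * r - r + (r - (V i i * r + U i i - r)) + (U i i - r) = 0.
  have e (v u t : A) : v - (v + u - t) + (u - t) = 0.
    by rewrite -(addrA v u) opprD (addrA v) subrr sub0r addNr.
  by rewrite [V i i * r - r + (r - _)]addrA subrK e.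
by rewrite mulr0.
Qed.

End Bilinear.

(** Only the actions on [H] modulo [N] are compared: this lets factors from [E(A, K)] be dropped
    although they are not trivial modulo [N]. *)
Definition eq_conj (g g0 : GL) : Prop := forall h, H h ->
  (pi g * pi h * (pi g)^-1 = pi g0 * pi h * (pi g0)^-1)%g.

Lemma eq_conjM g g0 g' g0' : eq_conj g g0 -> eq_conj g' g0' ->
  eq_conj (g * g')%g (g0 * g0')%g.
Proof.
move=> e e' h Hh.
have Hh' : H (g0' * h * g0'^-1)%g by apply: (commE_normalGL hn phiC A_qf).
have conjM (x y z : G) : (x * y * z * (x * y)^-1 = x * (y * z * y^-1) * x^-1)%g.
  by rewrite invgM !mulgA.
by rewrite !piM !conjM e' //; have := e _ Hh'; rewrite !piM (morphV piM).
Qed.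

Lemma eq_conjV g g0 : eq_conj g g0 -> eq_conj g^-1%g g0^-1%g.
Proof.
move=> e h Hh.
have Hh' : H (g0^-1 * h * g0^-1^-1)%g by apply: (commE_normalGL hn phiC A_qf).
have := e _ Hh'; rewrite !piM !(morphV piM) !invgK => e'.
apply: (mulgI (pi g)); apply: (mulIg (pi g)^-1%g); rewrite e'.
by rewrite !mulgA !mulgV !mul1g !mulgK.
Qed.

Lemma eq_conjK g' g : relE K g' -> eq_conj (g' * g)%g g.
Proof.
move=> Kg' h Hh; rewrite piM invgM.
have Hh' : H (g * h * g^-1)%g by apply: (commE_normalGL hn phiC A_qf).
by have := pi_conjK Hh' Kg'; rewrite !piM !(morphV piM) !mulgA.
Qed.

(** * Schur complements and independence of the conjugating matrix *)

Section Isogeny.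
Variables (p i j : 'I_n) (a b r : A).
Hypotheses (ip : i != p) (jp : j != p) (ij : i != j).
Hypotheses (Ia : I a) (Jb : J b) (rC : forall c, r * c = c * r).

(* The model is a g whose (p, p) entry has inverse W up to r: U is then r times
   the Schur complement of that entry and V its inverse, and conjugation by g is
   compared with X |-> U * X * V. *)
Definition isogeny (U V : 'M[A]_n) : Prop :=
  [/\ smx p p 1 * U = 0, V * smx p p 1 = 0, V * U = r%:M * (1 - smx p p 1),
      forall k l, l != p -> K (U k l - (if k == l then r else 0)) &
      forall k l, k != p -> K (V k l - (if l == k then 1 else 0))].

Section Fixed.
Variables U V : 'M[A]_n.
Hypothesis UV : isogeny U V.

Let PU k x : smx k p x * U = 0.
Proof. by case: UV => PU _ _ _ _; rewrite -[x]mulr1 -(smxM k p p) -mulrA PU mulr0. Qed.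

Let VP k x : V * smx p k x = 0.
Proof. by case: UV => _ VP _ _ _; rewrite -[x]mul1r -(smxM p p k) mulrA VP mul0r. Qed.

Let Up k : U p k = 0.
Proof. by have /matrixP/(_ p k) := PU p 1; rewrite smx_mulE eqxx mul1r mxE. Qed.

Let Vp k : V k p = 0.
Proof. by have /matrixP/(_ k p) := VP p 1; rewrite mul_smxE eqxx mulr1 mxE. Qed.

Let VU k l x : k != p -> V * (U * smx k l x) = smx k l (r * x).
Proof.
move=> kp; case: UV => _ _ VU _ _; rewrite mulrA VU -mulrA mulrBl mul1r.
by rewrite smxM0 1?eq_sym // subr0 scalar_mxM_smx.
Qed.

(** [D] is left open since the correction [t] is needed in different groups: in [E(A, K)] or
    [E(A, I)] for [x = a], in [N] for [x] in [Q]. *)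
Lemma isogeny_col (D : set GL) k x : is_subgroup D -> k != p ->
  (forall l, l != p -> D (el l p ((U l k - (if l == k then r else 0)) * x))) ->
  exists2 t, D t & unip (U * smx k p x) = (t * el k p (r * x))%g.
Proof.
move=> gD kp DU; pose S := [pred l | l != p].
pose M := U * smx k p x - smx k p (r * x).
have bs : block S (smx k p (r * x)) by apply: block_smx; rewrite //= eqxx.
have bU : block S (U * smx k p x).
  move=> l m; rewrite /= negb_and !negbK mul_smxE => /orP[/eqP->|/negPf->//].
  by rewrite Up mul0r if_same.
have bM : block S M by move=> l m lm; rewrite mxE bU // mxE bs // subrr.
exists (unip M).
  apply: (unip_block_mem gD bM) => l m /= lp; rewrite negbK => /eqP->.
  have -> : M l p = (U l k - (if l == k then r else 0)) * x.
    rewrite mxE mul_smxE [X in _ + X]mxE mxE !eqxx andbT mulrBl; congr (_ - _).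
    by case: ifP => // _; rewrite mul0r.
  exact: DU.
rewrite /el -unipD ?(block_mul bM bs, block_mul bs bM, block_mul bM bM, block_mul bs bs) //.
by rewrite subrK.
Qed.

Lemma isogeny_row (D : set GL) k x : is_subgroup D -> k != p ->
  (forall l, l != p -> D (el p l (x * (V k l - (if l == k then 1 else 0))))) ->
  exists2 t, D t & unip (smx p k x * V) = (t * el p k x)%g.
Proof.
move=> gD kp DV; pose S := pred1 p; pose M := smx p k x * V - smx p k x.
have bs : block S (smx p k x) by apply: block_smx; rewrite //= eqxx.
have bV : block S (smx p k x * V).
  move=> l m; rewrite /= negb_and negbK smx_mulE => /orP[/negPf->//|/eqP->].
  by rewrite Vp mulr0 if_same.
have bM : block S M by move=> l m lm; rewrite mxE bV // mxE bs // subrr.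
exists (unip M).
  apply: (unip_block_mem gD bM) => l m /= /eqP-> mp.
  have -> : M p m = x * (V k m - (if m == k then 1 else 0)).
    rewrite mxE smx_mulE [X in _ + X]mxE mxE !eqxx mulrBr; congr (_ - _) => /=.
    by case: ifP => _; rewrite ?mulr1 ?mulr0.
  exact: DV.
rewrite /el -unipD ?(block_mul bM bs, block_mul bs bM, block_mul bM bM, block_mul bs bs) //.
by rewrite subrK.
Qed.

Local Notation Up1 := (unip (U * smx i p a)).
Local Notation Uq1 := (unip (smx p j 1 * V)).
Local Notation Up2 := (unip (U * smx j p (r * (b * a)))).
Local Notation Uq2 := (unip (smx p i (- (r * b)) * V)).

(** The index [p], avoided by [i] and [j], factors the first matrix as a commutator of a column
    [Up1] and a row [Uq1]. Conjugation by the second matrix multiplies these by [Up2] and [Uq2],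
    with a factor [r] coming from [V * U]. *)
Lemma isogeny_comm :
  comm_elt (unip (U * smx i j a * V)) (unip (U * smx j i b * V)) =
  (comm_elt Up1 Uq1 * (comm_elt (Up1 * Up2) (Uq1 * Uq2))^-1)%g.
Proof.
have ji : j != i by rewrite eq_sym.
have colM k l x y : U * smx k p x * (U * smx l p y) = 0.
  by rewrite -!mulrA (mulrA _ U) PU mul0r mulr0.
have rowM k l x y : smx p k x * V * (smx p l y * V) = 0.
  by rewrite -!mulrA (mulrA V) VP mul0r mulr0.
have uE : comm_elt Up1 Uq1 = unip (U * smx i j a * V).
  rewrite unip_comm //; first by rewrite !mulrA -(mulrA U) smxM mulr1.
  by rewrite -mulrA VU // smxM0.
set W := U * smx j i b * V; set w := unip W.
have W2 : W * W = 0.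
  by rewrite /W -!mulrA (mulrA V U) (mulrA (V * U)) -(mulrA V U) VU // !mulrA
    -(mulrA U) smxM0 // mulr0 mul0r.
have colW k x : U * smx k p x * W = 0.
  by rewrite /W !mulrA -(mulrA U (smx k p x)) PU mulr0 !mul0r.
have wp : (w * Up1 * w^-1 = Up1 * Up2)%g.
  rewrite unipJ // uval_unip // uinv_unip // -unipD //; congr unip.
  have WM : W * (U * smx i p a) = U * smx j p (r * (b * a)).
    by rewrite /W -mulrA VU // -mulrA smxM !mulrA rC.
  by rewrite [(1 + W) * _]mulrDl mul1r WM mulrBr mulr1 mulrDl !colW addr0 subr0.
have Wrow k x : W * (smx p k x * V) = 0.
  by rewrite /W -!mulrA (mulrA V (smx p k x)) VP mul0r !mulr0.
have wq : (w * Uq1 * w^-1 = Uq1 * Uq2)%g.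
  rewrite unipJ // uval_unip // uinv_unip // -unipD //; congr unip.
  rewrite [(1 + W) * _]mulrDl mul1r Wrow addr0 mulrBr mulr1; congr (_ + _).
  rewrite smxN mulNr; congr (- _).
  by rewrite /W -!mulrA (mulrA U) (mulrA V) VU // mulrA smxM mul1r.
by rewrite -uE comm_eltE comm_eltJ wp wq.
Qed.

Local Notation p0 := (el i p (r * a)).
Local Notation q0 := (el p j 1).
Local Notation p20 := (el j p (r * (r * (b * a)))).
Local Notation q20 := (el p i (- (r * b))).

(** The right side no longer involves [U] and [V]: this is how the dependence on [g] disappears. *)
Lemma isogeny_pi_comm :
  pi (comm_elt (unip (U * smx i j a * V)) (unip (U * smx j i b * V))) =
  (pi (p0 * q0 * p0^-1 * (p0 * comm_elt p20 q20 * p0^-1 * comm_elt p0 q20) *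
      (p0 * q0 * p0^-1)^-1)^-1 * (pi (p0 * comm_elt p20 q0 * p0^-1))^-1)%g.
Proof.
have [PU0 VP0 VU0 KU KV] := UV.
have pi' : p != i by rewrite eq_sym.
have pj : p != j by rewrite eq_sym.
have Qba : Q (b * a) by case: (symm_prodP Ia Jb).
have Ira : I (r * a) by apply: idealMl.
have Jrb : J (- (r * b)) by apply/idealN/idealMl.
have Irba : I (r * (b * a)) by do 2!apply: idealMl.
have Irrba : I (r * (r * (b * a))) by apply: idealMl.
have Qrba : Q (r * (b * a)) by apply: idealMl.
have Qp20 : relE Q p20 by apply: relE_el => //; apply: idealMl.
have QH := @relE_symm_prod_sub n A hn I J.
have [kp Kkp eP] : exists2 t, relE K t & Up1 = (t * p0)%g.
  apply: isogeny_col (relE_group n K) ip _ => l lp; apply: relE_el => //.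
  by apply: idealMr; apply: KU.
have [kq Kkq eQ] : exists2 t, relE K t & Uq1 = (t * q0)%g.
  apply: isogeny_row (relE_group n K) jp _ => l lp; rewrite mul1r.
  by apply: relE_el; [rewrite eq_sym | apply: KV].
have [kp2 Nkp2 eP2] : exists2 t, NN t & Up2 = (t * p20)%g.
  apply: isogeny_col (commE_group n Q K) jp _ => l lp.
  apply: (level_el (gD := commE_group n Q K)) => //.
  by have [] := commE_level hn Qrba (KU l j jp).
have [kq2 Kkq2 eQ2] : exists2 t, relE K t & Uq2 = (t * q20)%g.
  apply: isogeny_row (relE_group n K) ip _ => l lp.
  by apply: relE_el; [rewrite eq_sym | apply: idealMl; apply: KV].
have IP : relE I Up1.
  have [|t It ->] := isogeny_col (x := a) (relE_group n I) ip.
    by move=> l lp; apply: relE_el => //; apply: idealMl.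
  by have [_ IM _] := relE_group n I; apply: (IM) => //; apply: relE_el.
have JQ2 : relE J Uq2.
  have [|t It ->] := isogeny_row (x := - (r * b)) (relE_group n J) ip.
    by move=> l lp; apply: relE_el; [rewrite eq_sym | apply: idealMr].
  by have [_ IM _] := relE_group n J; apply: (IM) => //; apply: relE_el.
have Jq20 : relE J q20 by apply: relE_el.
have Ip20 : relE I p20 by apply: relE_el.
have Eq0 : EA q0 by apply: E_el.
have HP2Q : H (comm_elt p20 q0).
  by apply: QH; apply: (comm_mem (relE_group n Q) (@relE_normal _ _ Q)).
have piP2 : pi Up2 = pi p20.
  by rewrite eP2 piM (iffRL (pi1 kp2) Nkp2) mul1g.
have c1 : pi (comm_elt Up2 Uq2) = pi (comm_elt p20 q20).
  rewrite (morph_comm piM) piP2 -(morph_comm piM) eQ2 comm_eltMr piM.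
  rewrite (iffRL (pi1 _) (mem_comm_subgroup Qp20 Kkq2)) mul1g.
  by apply: pi_conjK => //; apply: commH.
(* The one commutator among the three without a factor in [E(A, Q)] modulo [N]; it needs the
   [(i, i)] entry of [V * U] to be [r]. *)
have c2 : pi (comm_elt Up1 Uq2) = pi (comm_elt p0 q20).
  apply: pi_comm_transvection => //.
  - by move=> k; apply: KU.
  - by move=> k; apply: KV.
  - by have /matrixP/(_ i i) := VU0; rewrite -[LHS]/((V *m U) i i) mxE => ->;
    rewrite mulrBr mulr1 scalar_mxM_smx !mxE eqxx (negPf ip) subr0.
have c3 : pi (comm_elt Up2 Uq1) = pi (comm_elt p20 q0).
  rewrite (morph_comm piM) piP2 -(morph_comm piM) eQ comm_eltMr piM.
  rewrite (iffRL (pi1 _) (mem_comm_subgroup Qp20 Kkq)) mul1g.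
  exact: pi_conjK.
have cP : eq_conj Up1 p0 by rewrite eP; apply: eq_conjK.
have cQ : eq_conj Uq1 q0 by rewrite eQ; apply: eq_conjK.
have cPQP := eq_conjM (eq_conjM cP cQ) (eq_conjV cP).
have Hd : H (comm_elt p20 q20) by apply: commH.
have He : H (comm_elt p0 q20) by apply: commH => //; apply: relE_el.
have [_ HM _] := commE_group n I J.
have Hd' : H (p0 * comm_elt p20 q20 * p0^-1)%g by apply: (commE_normalGL hn phiC A_qf).
have Hh : H (p0 * comm_elt p20 q20 * p0^-1 * comm_elt p0 q20)%g by apply: HM.
have conjE (x y : GL) : pi (x * y * x^-1)%g = (pi x * pi y * (pi x)^-1)%g.
  by rewrite !piM (morphV piM).
have piinv := morphV piM.
have hE : pi (Up1 * comm_elt Up2 Uq2 * Up1^-1 * comm_elt Up1 Uq2)%g =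
    pi (p0 * comm_elt p20 q20 * p0^-1 * comm_elt p0 q20)%g.
  by rewrite [LHS]piM [RHS]piM !conjE c1 c2 (cP _ Hd).
rewrite isogeny_comm comm_elt_expand [LHS]piM !piinv.
rewrite !conjE c3 (cP _ HP2Q); congr (_^-1 * _)%g; rewrite hE.
by have := cPQP _ Hh; rewrite !conjE => ->.
Qed.

End Fixed.
(** The pair attached to [g = 1] and [W = r], against which all others are compared. *)
Lemma isogeny_std : isogeny (r%:M * (1 - smx p p 1)) (1 - smx p p 1).
Proof.
have P2 : (1 - smx p p 1) * smx p p 1 = 0 :> 'M[A]_n.
  by rewrite mulrBl mul1r smxM mulr1 subrr.
have P2' : smx p p 1 * (1 - smx p p 1) = 0 :> 'M[A]_n.
  by rewrite mulrBr mulr1 smxM mulr1 subrr.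
have rhoC := scalar_mx_central _ rC.
split=> //.
- by rewrite mulrA -rhoC -mulrA P2' mulr0.
- by rewrite mulrA -rhoC -mulrA [X in _ * X]mulrBr mulr1 P2 subr0.
- move=> k l lp; rewrite mulrBr mulr1 scalar_mxM_smx mulr1 !mxE (negPf lp) andbF.
  by rewrite subr0; case: eqP => _; rewrite ?mulr1n ?mulr0n subrr; apply: ideal0.
- move=> k l kp; rewrite !mxE (negPf kp) subr0 eq_sym.
  by case: eqP => _; rewrite ?mulr1n ?mulr0n subrr; apply: ideal0.
Qed.

Lemma isogeny_pi U V : isogeny U V ->
  pi (comm_elt (unip (U * smx i j a * V)) (unip (U * smx j i b * V))) =
  pi (comm_elt (el i j (r * a)) (el j i (r * b))).
Proof.
move=> UV; rewrite (isogeny_pi_comm UV) -(isogeny_pi_comm isogeny_std).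
have std k l x : k != p -> l != p ->
    r%:M * (1 - smx p p 1) * smx k l x * (1 - smx p p 1) = smx k l (r * x) :> 'M[A]_n.
  move=> kp lp; rewrite -(mulrA _ _ (smx k l x)) mulrBl mul1r smxM0 1?eq_sym // subr0.
  by rewrite scalar_mxM_smx mulrBr mulr1 smxM0 // subr0.
by rewrite !std.
Qed.

(** Isolates two factors [rho] in the expansion of [unip_commM]. In the conjugate by [g], one turns
    [Z] into [U + C * Z], the other turns [M * h] into [M * V * (rho - C)]. *)
Lemma kappa_scale (rho m1 m2 : 'M[A]_n) : (forall X, rho * X = X * rho) ->
  let M1 := rho * m1 in let M2 := rho * m2 in
  M1 * M2 - M2 * M1 - M1 * M2 * M1 + M2 * M1 * M2 + M1 * M2 * M1 * M2 =
  rho * rho * (m1 * m2 - m2 * m1 - rho * (m1 * m2 * m1) + rho * (m2 * m1 * m2)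
    + rho * rho * (m1 * m2 * m1 * m2)).
Proof.
move=> C /=.
have e X Y : rho * X * (rho * Y) = rho * rho * (X * Y).
  by rewrite -!mulrA (mulrA X) -C !mulrA.
have e3 X Y : rho * rho * X * (rho * Y) = rho * rho * (rho * (X * Y)).
  by rewrite -!mulrA (mulrA X) -C !mulrA.
have e4 X Y : rho * rho * X * (rho * rho * Y) = rho * rho * (rho * rho * (X * Y)).
  have RC : X * (rho * rho) = rho * rho * X.
    by rewrite mulrA -C -mulrA -C mulrA.
  by rewrite -(mulrA _ X) (mulrA X) RC -!mulrA.
rewrite -(mulrA (rho * m1 * (rho * m2))) !e !e3 e4 !mulrA.
by rewrite !mulrDr !mulrN !mulrA.
Qed.

(** Block elimination at the [(p, p)] entry writes the conjugate as [unip L], the commutator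
    transported by [U] and [V], and [unip N]. The entries of [L] and the row defining [N] are sums
    of products of elements of [Q] and [K], so the outer factors are trivial under [pi]. *)
Lemma pi_conj_local g W : congGL K g -> uval g p p * W = r -> W * uval g p p = r ->
  pi (g * comm_elt (el i j (r * a)) (el j i (r * b)) * g^-1)%g =
  pi (comm_elt (el i j (r * a)) (el j i (r * b))).
Proof.
move=> Kg xW Wx.
have Z1 : mx_in K (uval g - 1) by apply/congGL_mx.
have h1 : mx_in K (uinv g - 1) by apply: congGL_inv_mx.
have hZ := uinvK g.
have [Z ZE] : exists Z, Z = uval g by eexists.
have [h hE] : exists h, h = uinv g by eexists.
rewrite -ZE in Z1 hZ xW Wx; rewrite -hE in h1 hZ.
pose P : 'M[A]_n := smx p p 1; pose rho : 'M[A]_n := r%:M.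
have rhoC X : rho * X = X * rho by apply: scalar_mx_central.
pose w : 'M[A]_n := smx p p W.
have Pw : P * w = w by rewrite smxM mul1r.
have PP : P * P = P by rewrite smxM mulr1.
have [C CE] : exists C, C = Z * w by eexists.
have CP : C * P = C by rewrite CE -mulrA smxM mulr1.
have PC : P * C = rho * P.
  rewrite CE scalar_mxM_smx mulr1 mulrA; apply/matrixP => k l.
  by rewrite mul_smxE smx_mulE mxE; case: (l == p); case: (k == p);
    rewrite ?mul1r ?mul0r // xW.
have [U UE] : exists U, U = rho * Z - C * Z by eexists.
(* The inverse of a Schur complement is the complementary block of the inverse matrix. *)
have [V VE] : exists V, V = (1 - P) * h * (1 - P) by eexists.
have P1 : (1 - P) * P = 0 by rewrite mulrBl mul1r PP subrr.
have P1' : P * (1 - P) = 0 by rewrite mulrBr mulr1 PP subrr.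
have PU : P * U = 0.
  by rewrite UE mulrBr !mulrA PC -rhoC subrr.
have VP : V * P = 0 by rewrite VE -mulrA P1 mulr0.
have UV : isogeny U V.
  split=> //.
  - have hU : h * U = rho - w * Z.
      by rewrite UE mulrBr CE rhoC !mulrA hZ !mul1r.
    have PU' : (1 - P) * U = U by rewrite mulrBl mul1r PU subr0.
    rewrite VE -[LHS]mulrA PU' -mulrA hU mulrBr mulrA [(1 - P) * w]mulrBl mul1r Pw.
    by rewrite subrr mul0r subr0 -rhoC.
  - move=> k l lp; have -> : U k l = r * Z k l - Z k p * (W * Z p l).
      rewrite UE CE -(mulrA Z) mxE [X in _ + X]mxE mul_smx_mulE.
      by rewrite -mulmxE mul_scalar_mx mxE.
    have Kx : K (Z k p * (W * Z p l)).
      by do 2!apply: idealMl; apply: (mx_in_diff Z1); rewrite eq_sym.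
    rewrite addrAC; apply: idealB => //.
    have -> : r * Z k l - (if k == l then r else 0) = r * (Z - 1) k l.
      by rewrite !mxE mulrBr; case: eqP => _; rewrite ?mulr1n ?mulr1 // mulr0.
    by apply: idealMl; apply: Z1.
  - move=> k l kp; have VE' : V k l = h k l - (if l == p then h k p else 0).
      have PhE m : ((1 - P) * h) k m = h k m.
        by rewrite mulrBl mul1r mxE [X in _ + X]mxE smx_mulE (negPf kp) subr0.
      rewrite VE [_ * (1 - P)]mulrBr mulr1 mxE [X in _ + X]mxE mul_smxE !PhE.
      by rewrite mulr1.
    rewrite VE'; have [->|lp] := eqVneq l p.
      by rewrite subrr [p == k]eq_sym (negPf kp) subr0; apply: ideal0.
    by have := h1 k l; rewrite subr0 !mxE eq_sym; case: eqP.
rewrite -(isogeny_pi UV).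
pose m1 : 'M[A]_n := smx i j a; pose m2 : 'M[A]_n := smx j i b.
have pi' : p != i by rewrite eq_sym.
have pj : p != j by rewrite eq_sym.
have [M ME] : exists M, M = m1 * m2 - m2 * m1 - rho * (m1 * m2 * m1) +
  rho * (m2 * m1 * m2) + rho * rho * (m1 * m2 * m1 * m2) by eexists.
have Pm1 : P * m1 = 0 by rewrite smxM0.
have Pm2 : P * m2 = 0 by rewrite smxM0.
have m1P : m1 * P = 0 by rewrite smxM0.
have m2P : m2 * P = 0 by rewrite smxM0.
have MP : M * P = 0.
  by rewrite ME !mulrDl !mulNr -!mulrA m1P m2P !mulr0 !subr0 !addr0.
have PM : P * M = 0.
  by rewrite ME !mulrDr !mulrN !mulrA -!rhoC -!mulrA !(mulrA P) Pm1 Pm2 !mul0r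
    !mulr0 !subr0 !addr0.
have QM : mx_in Q M.
  have [ab ba] := symm_prodP Ia Jb.
  have Q12 : mx_in Q (m1 * m2) by rewrite smxM; apply: mx_in_smx.
  have Q21 : mx_in Q (m2 * m1) by rewrite smxM; apply: mx_in_smx.
  rewrite ME; apply: mx_inD; last by apply: mx_inMl; rewrite -mulrA; apply: mx_inMl.
  apply: mx_inD; last by apply: mx_inMl; apply: mx_inMr.
  apply: mx_inB; last by apply: mx_inMl; apply: mx_inMr.
  exact: mx_inB.
have VU0 : V * U = rho * (1 - P) by case: UV.
have yE : uval (comm_elt (el i j (r * a)) (el j i (r * b))) = 1 + rho * rho * M.
  have ji : j != i by rewrite eq_sym.
  by rewrite unip_commM ?smx_sq // -!scalar_mxM_smx kappa_scale // ME.
have VUm k l x : k != p -> V * (U * smx k l x) = rho * smx k l x.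
  by move=> kp; rewrite mulrA VU0 -mulrA mulrBl mul1r smxM0 1?eq_sym // subr0.
have YE : uval (comm_elt (unip (U * m1 * V)) (unip (U * m2 * V))) = 1 + rho * (U * M * V).
  have e X k l x : k != p ->
      U * X * V * (U * smx k l x * V) = rho * (U * (X * smx k l x) * V).
    move=> kp; have -> : U * X * V * (U * smx k l x * V) = U * X * (V * (U * smx k l x)) * V.
      by rewrite !mulrA.
    by rewrite VUm // (mulrA (U * X)) -(rhoC (U * X)) -!mulrA.
  have sq1 : U * m1 * V * (U * m1 * V) = 0 by rewrite e // smx_sq // mulr0 mul0r mulr0.
  have sq2 : U * m2 * V * (U * m2 * V) = 0.
    by rewrite e // smx_sq ?mulr0 ?mul0r ?mulr0 // eq_sym.
  rewrite unip_commM //; congr (1 + _).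
  rewrite [U * m1 * V * (U * m2 * V)]e // [U * m2 * V * (U * m1 * V)]e // -/m1 -/m2.
  rewrite -!(mulrA rho) !e // -!(mulrA rho) e // -/m1 -/m2.
  have er X : U * (rho * X) * V = rho * (U * X * V).
    by rewrite mulrA -(rhoC U) -!mulrA.
  rewrite ME -(mulrA rho rho) !(mulrDr U) !mulrN !(mulrDl _ _ V) !mulNr !er.
  by rewrite !(mulrDr rho) !(mulrN rho).
have [L LE] : exists L, L = - (U * M * V * C) by eexists.
have CU : C * U = 0 by rewrite -CP -mulrA PU mulr0.
have annC : (rho - C) * C = 0 by apply: (tau_ann rC CP PC).
have [N NE] : exists N, N = C * (P * Z * M * V) * (rho - C) by eexists.
have N2 : N * N = 0 by rewrite NE -!mulrA (mulrA _ C) annC mul0r !mulr0.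
have L2 : L * L = 0.
  by rewrite LE mulrNN -!mulrA (mulrA C U) CU mul0r !mulr0.
have gE : (g * comm_elt (el i j (r * a)) (el j i (r * b)) * g^-1 =
    unip L * comm_elt (unip (U * m1 * V)) (unip (U * m2 * V)) * unip N)%g.
  apply: uval_inj; rewrite [LHS]uvalM [uval (g * _)%g]uvalM uvalV [RHS]uvalM.
  rewrite [uval (unip L * _)%g]uvalM yE YE !uval_unip // -ZE -hE.
  have Zh : Z * h = 1 by rewrite ZE hE uvalK.
  have MhV : M * h * (1 - P) = M * V.
    by rewrite VE !mulrA [M * (1 - P)]mulrBr mulr1 MP subr0.
  have MhP : rho * (M * h * P) = - (M * V * C).
    rewrite rhoC -mulrA -rhoC -PC mulrA -{1}[P](subKr 1) mulrBr mulr1 MhV mulrBl.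
    by rewrite CE !mulrA -(mulrA M h) hZ mulr1 -Pw mulrA MP mul0r sub0r.
  have Mh : rho * (M * h) = M * V * (rho - C).
    rewrite -[M * h]mulr1 -[1](subrK P) mulrDr MhV mulrDr MhP mulrBr.
    by rewrite -rhoC.
  have ZM : rho * Z = U + C * Z by rewrite UE subrK.
  have N1N : U * M * V * (rho - C) * N = 0 by rewrite NE -!mulrA (mulrA _ C) annC mul0r !mulr0.
  have -> : Z * (1 + rho * rho * M) * h = 1 + (U * M * V * (rho - C) + N).
    rewrite mulrDr mulr1 mulrDl Zh; congr (1 + _).
    have -> : Z * (rho * rho * M) * h = rho * Z * (rho * (M * h)).
      by rewrite [rho * Z]rhoC -!mulrA.
    by rewrite Mh ZM mulrDl NE !mulrA CP.
  have -> : (1 + L) * (1 + rho * (U * M * V)) = 1 + U * M * V * (rho - C).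
    have CT : C * (U * M * V) = 0 by rewrite !mulrA CU !mul0r.
    have LT : L * (rho * (U * M * V)) = 0.
      by rewrite rhoC mulrA LE mulNr -(mulrA _ C) CT mulr0 oppr0 mul0r.
    rewrite mulrDr mulr1 [(1 + L) * _]mulrDl mul1r LT addr0 -addrA; congr (1 + _).
    by rewrite LE addrC mulrBr -rhoC.
  by rewrite [RHS]mulrDr mulr1 [_ * N]mulrDl mul1r N1N addr0 -addrA.
rewrite gE !piM.
have -> : pi (unip L) = 1%g.
  have KC : mx_in K ((1 - P) * C).
    move=> k l; rewrite mulrBl mul1r PC mxE [X in _ + X]mxE CE mul_smxE.
    rewrite scalar_mxM_smx mxE mulr1; have [->|kp] := eqVneq k p.
      by case: (l == p); rewrite ?xW subrr; apply: ideal0.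
    case: (l == p); rewrite /= subr0; last exact: ideal0.
    by apply: idealMr; apply: (mx_in_diff Z1).
  have LL : mx_in (level (commE_group n Q K)) L.
    rewrite LE; apply: mx_inN; rewrite -!mulrA; apply: mx_inMl.
    have -> : V * C = (1 - P) * h * ((1 - P) * C) by rewrite VE !mulrA.
    apply: (mx_in_mul _ QM (mx_inMl _ KC)) => q k Qq Kk.
    by case: (commE_level hn Qq Kk).
  apply/pi1; apply: (@unip_block_mem _ _ [pred k | k != p]) => [||k l kp lp].
  - exact: commE_group.
  - move=> k l; rewrite /= negb_and !negbK => /orP[/eqP->|lp].
      have /matrixP/(_ p l) : P * L = 0 by rewrite LE mulrN !mulrA PU !mul0r oppr0.
      by rewrite smx_mulE eqxx mul1r mxE.
    by rewrite LE -CP mxE mulrA mul_smxE (negPf lp) oppr0.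
  - by apply: (level_el (LL k l)); apply: contraNneq lp => <-.
have -> : pi (unip N) = 1%g.
  apply/pi1; rewrite NE.
  apply: (tau_level (gD := commE_group n Q K) hn (@commE_normalEA _ _ Q K) rC CP PC).
  - have KPZ : mx_in K (P * Z * (1 - P)).
      move=> k l; rewrite mulrBr mulr1 mxE [X in _ + X]mxE mul_smxE !smx_mulE.
      have [->|lp] := eqVneq l p; first by rewrite mulr1 subrr; apply: ideal0.
      rewrite subr0; case: ifP => _; last exact: ideal0.
      by apply: idealMl; apply: (mx_in_diff Z1); rewrite eq_sym.
    apply: mx_inMr; have -> : P * Z * M = P * Z * (1 - P) * M.
      by rewrite -[RHS]mulrA [(1 - P) * M]mulrBl mul1r PM subr0.
    apply: (mx_in_mul _ KPZ QM) => k q Kk Qq.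
    by case: (commE_level hn Qq Kk).
  - by rewrite !mulrA PP.
  - by rewrite -mulrA VP mulr0.
by rewrite mul1g mulg1.
Qed.

End Isogeny.

End TripleCommutators.

(** * Removing the denominators, and induction on the number of ideals *)

Section MultipleCommutators.
Variables (n : nat) (hn : (3 <= n)%N) (R : comPzRingType) (A : pzRingType).
Variables (phi : {rmorphism R -> A}).
Hypotheses (phiC : central_morphism phi) (A_qf : quasi_finite phi).
Local Notation GL := (GL n A).
Local Notation EA := (E n (setT : set A)).
Local Notation relE := (relE n).
Local Notation congGL := (congGL n).
Local Notation commE := (@commE n A).
Implicit Types (I J K : ideal A).

(** Modulo [E(A, Q)] both commutators are inverse to [[e_pj(a), e_jp(- b c)]] at a third index [p],
    by [el_conj_comm] taken once with [c] and once with 1. *)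
Lemma comm_el_central_shift I J i j a b c : i != j -> I a -> J b ->
  (forall d, c * d = d * c) ->
  relE (symm_prod I J) (comm_elt (el i j (c * a)) (el j i b) *
    (comm_elt (el i j a) (el j i (c * b)))^-1)%g.
Proof.
move=> ij Ia Jb cC; set Q := symm_prod I J.
have [p [pi_ pj]] := third_index i j hn.
have ip : i != p by rewrite eq_sym.
have ji : j != i by rewrite eq_sym.
have jp : j != p by rewrite eq_sym.
have nQ := relE_normalGL hn phiC A_qf (I := Q).
have gQ := relE_group n Q; have [_ QM QV] := gQ.
have [G [q [qM q1]]] := quotient_group gQ nQ.
have qel k l x y : k != l -> I x -> J y -> q (el k l (x * y)) = 1%g.
  by move=> kl Ix Jy; apply/q1; apply: relE_el => //; case: (symm_prodP Ix Jy).
have qc g h : EA g -> commE I J h -> q (g * h * g^-1)%g = q h.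
  move=> Eg Hh; have Qh := commE_congGL Hh.
  have /q1 : relE Q (comm_elt g h) by apply: (comm_EA_congGL hn phiC A_qf).
  by move/(congr1 (fun t => t * q h)%g); rewrite mul1g -qM /comm_elt mulgVK.
have shift d x y : I x -> J y -> q (comm_elt (el i j (d * x)) (el j i y) *
    comm_elt (el p j x) (el j p (- (y * d))))%g = 1%g.
  move=> Ix Jy.
  have := congr1 q (el_conj_comm x y d ip ij pj).
  have Idx : I (d * x) by apply: idealMl.
  have Jyd : J (- (y * d)) by apply/idealN/idealMr.
  set X' := el i j (d * x); set X := el p j x; set Z' := el j p _; set Z := el j i y.
  have IX' : relE I X' by apply: relE_el.
  have IX : relE I X by apply: relE_el.
  have JZ' : relE J Z' by apply: relE_el.
  have JZ : relE J Z by apply: relE_el.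
  have JZZ : relE J (Z' * Z)%g by have [_ JM _] := relE_group n J; apply: JM.
  have er u v w : relE I u -> relE J v -> relE J w ->
      q (comm_elt u (v * w)%g) = (q (comm_elt u v) * q (comm_elt u w))%g.
    move=> Iu Jv Jw.
    have <- : q (v * comm_elt u w * v^-1)%g = q (comm_elt u w).
      by apply: qc; [apply: relE_EA Jv | apply: mem_comm_subgroup].
    by rewrite -qM; congr q; exact: comm_eltMr.
  have el u v w : relE I u -> relE I v -> relE J w ->
      q (comm_elt (u * v)%g w) = (q (comm_elt v w) * q (comm_elt u w))%g.
    move=> Iu Iv Jw.
    have <- : q (u * comm_elt v w * u^-1)%g = q (comm_elt v w).
      by apply: qc; [apply: relE_EA Iu | apply: mem_comm_subgroup].
    by rewrite -qM; congr q; exact: comm_eltMl.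
  have q10 : q (comm_elt X Z) = 1%g.
    by rewrite /X /Z comm_el //; apply: qel.
  have q01 : q (comm_elt X' Z') = 1%g.
    by rewrite /X' /Z' comm_el //; apply: qel.
  rewrite el // er // er // q10 q01 mulg1 mul1g.
  move: (comm_elt X Z') (comm_elt X' Z) => u v quv.
  rewrite [RHS](_ : _ = 1%g) in quv.
    by rewrite qM; apply: (mulgI (q u)); rewrite mulgA quv mul1g mulg1.
  apply/q1; apply: nQ => //; apply: relE_el => //.
  by have [] := symm_prodP Ix Jy.
have s1 := shift c a b Ia Jb.
have := shift 1 a (c * b) Ia (idealMl c Jb).
rewrite mul1r mulr1 [c * b]cC; move: s1.
move: (comm_elt (el p j _) _) (comm_elt (el i j (c * a)) _) => u v.
move: (comm_elt _ _) => w.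
move=> vu wu; apply/q1; rewrite [LHS]qM (morphV qM).
by rewrite -[q v](mulgK (q u)) -[q w](mulgK (q u)) -!qM vu wu mulgV.
Qed.

(* Modulo E(A, Q), x |-> [e_ij(x), e_ji(b)] turns sums into products, so the s in
   R whose multiples satisfy the claim for s * a form an ideal. *)
Lemma comm_comm_elt_congGL I J K i j a b g : i != j -> I a -> J b -> congGL K g ->
  commE (symm_prod I J) K (comm_elt (comm_elt (el i j a) (el j i b)) g).
Proof.
move=> ij Ia Jb Kg; set Q := symm_prod I J; set NN := commE Q K.
have ji : j != i by rewrite eq_sym.
have gN : is_subgroup NN := commE_group n Q K; have [N1 NM NV] := gN.
have nN : normalizes setT NN := @commE_normalGL _ hn _ _ _ phiC A_qf Q K.
have [G [pi [piM pi1]]] := quotient_group gN nN.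
pose y x := comm_elt (el i j x) (el j i b).
have yC x : I x -> commE I J (y x).
  by move=> Ix; apply: mem_comm_subgroup; apply: relE_el.
have QN h : relE Q h -> NN (comm_elt h g).
  by move=> Qh; apply: (comm_relE_congGL_commE hn phiC A_qf).
have NMg u v : NN (comm_elt u g) -> NN (comm_elt v g) -> NN (comm_elt (u * v)%g g).
  by move=> Nu Nv; rewrite comm_eltMl; apply: (NM) => //; apply: nN.
have NVg u : NN (comm_elt u g) -> NN (comm_elt u^-1%g g).
  by move=> Nu; rewrite comm_eltVl; apply: nN => //; apply: NV.
have yD x x' : I x -> I x' -> exists2 h, relE Q h & y (x + x') = (h * y x' * y x)%g.
  move=> Ix Ix'; exists (comm_elt (el i j x) (y x')).
    apply: (comm_EA_congGL hn phiC A_qf); first exact: E_el.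
    by apply: commE_congGL; apply: yC.
  by rewrite /y elD // comm_eltMl; congr (_ * _)%g; symmetry; exact: mulgVK.
have HB x x' : I x -> I x' -> NN (comm_elt (y x) g) -> NN (comm_elt (y x') g) ->
    NN (comm_elt (y (x - x')) g).
  move=> Ix Ix' Nx Nx'; have [h Qh] := yD (x - x') x' (idealB Ix Ix') Ix'.
  rewrite subrK => e.
  have -> : y (x - x') = ((h * y x')^-1 * y x)%g by rewrite e mulKg.
  by apply: (NMg) => //; apply: NVg; apply: (NMg) => //; apply: QN.
pose q_set : set R := [set r | forall s, NN (comm_elt (y (phi (s * r) * a)) g)].
have Ira r : I (phi r * a) by apply: idealMl.
have q0 : q_set 0.
  by move=> s; rewrite mulr0 rmorph0 mul0r /y el0 [comm_elt 1 (el _ _ _)]comm_1elt comm_1elt.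
have qB r r' : q_set r -> q_set r' -> q_set (r - r').
  by move=> qr qr' s; rewrite mulrBr rmorphB mulrBl; apply: HB.
have qMl s r : q_set r -> q_set (s * r) by move=> qr t; rewrite mulrA.
have qMr s r : q_set r -> q_set (r * s) by rewrite mulrC; apply: qMl.
pose q := Ideal q0 qB qMl qMr.
suff /(_ 1) : q 1 by rewrite mul1r rmorph1 mul1r.
apply: contrapT => /exists_maximal_ideal[m [mmax qm]].
have [p [pi_ pj]] := third_index i j hn.
have [eps [W [r [Keps _ mr xW Wx]]]] := local_unit_entry phiC A_qf p Kg mmax.
apply: (maximal_ideal_prime mmax mr mr); apply: qm => s.
have [_ KM _] := congGL_group n K.
have Keg : congGL K (eps * g)%g by apply: (KM) => //; apply: relE_congGL.
have ip : i != p by rewrite eq_sym.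
have jp : j != p by rewrite eq_sym.
have := pi_conj_local hn phiC A_qf piM pi1 ip jp ij (Ira s) Jb (phiC r) Keg xW Wx.
set h := comm_elt (el i j _) _ => eh.
have Ch : commE I J h.
  apply: mem_comm_subgroup; apply: relE_el => //; first exact: idealMl.
  exact: idealMl.
have Nhe : NN (comm_elt h eps) by apply: (comm_commE_relE hn phiC A_qf).
have Nhg : NN (comm_elt h g).
  have Nheg : NN (comm_elt h (eps * g)%g).
    rewrite -comm_eltV; apply: NV; apply/pi1.
    by rewrite /comm_elt [LHS]piM eh -piM mulgV morph1.
  have -> : comm_elt h g = (eps^-1 * ((comm_elt h eps)^-1 * comm_elt h (eps * g)) * eps^-1^-1)%g.
    by rewrite comm_eltMr mulKg invgK mulgA mulKg mulgVK.
  by apply: nN => //; apply: (NM) => //; apply: NV.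
have rsC d : phi r * d = d * phi r by apply: phiC.
(* [pi_conj_local] has a factor [r] in each entry, while the ideal [q] scales only the first; the
   second [r] is moved over at the cost of a factor in [E(A, Q)]. *)
have := comm_el_central_shift ij (idealMl (phi r) (Ira s)) Jb rsC.
have -> : phi r * (phi r * (phi s * a)) = phi (s * (r * r)) * a.
  by rewrite !mulrA -!rmorphM mulrC mulrA.
rewrite -/(y _) -/h => Qyh.
have -> : y (phi (s * (r * r)) * a) = (y (phi (s * (r * r)) * a)%R * h^-1 * h)%g.
  by rewrite mulgVK.
by apply: (NMg) => //; apply: QN.
Qed.

Lemma comm_commE_congGL I J K h g : commE I J h -> congGL K g ->
  commE (symm_prod I J) K (comm_elt h g).
Proof.
set Q := symm_prod I J; set NN := commE Q K.
have gN : is_subgroup NN := commE_group n Q K; have [N1 NM NV] := gN.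
have nN : normalizes setT NN := @commE_normalGL _ hn _ _ _ phiC A_qf Q K.
pose D : set GL := [set h | forall g, congGL K g -> NN (comm_elt h g)].
have gD : is_subgroup D.
  split=> [t _|u v Du Dv t Kt|u Du t Kt].
  - by rewrite comm_1elt.
  - by rewrite comm_eltMl; apply: (NM); [apply: nN => //; apply: Dv | apply: Du].
  - by rewrite comm_eltVl; apply: nN => //; apply: NV; apply: Du.
have nD : normalizes EA D.
  by move=> t u _ Du w Kw; rewrite -(conjVK t w) -comm_eltJ; apply: nN => //; apply: Du; apply: congGL_normal.
have QD : relE Q `<=` D by move=> u Qu t; apply: (comm_relE_congGL_commE hn phiC A_qf).
move=> Hh; suff : commE I J `<=` D by move=> /(_ h Hh g).
apply: comm_subgroup_min => // u v Iu Jv.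
apply: (comm_relE_congGL hn phiC A_qf (gD := gD) nD _ _ Iu (relE_congGL Jv)).
  move=> a b Ia Jb; have [Qab Qba] := symm_prodP Ia Jb.
  by split=> k l x y kl; apply: QD; apply: relE_level.
by move=> k l a b kl Ia Jb t; apply: comm_comm_elt_congGL.
Qed.

Lemma comm_relE_congGL_eq I J : comm_subgroup (relE I) (congGL J) = commE I J.
Proof.
apply/seteqP; split; apply: comm_subgroup_min; do ?exact: comm_subgroup_group.
  by move=> x y; apply: (comm_relE_congGL_commE hn phiC A_qf).
by move=> x y Ix Jy; apply: mem_comm_subgroup => //; apply: relE_congGL.
Qed.

Lemma comm_commE_congGL_eq I J K :
  comm_subgroup (commE I J) (congGL K) = commE (symm_prod I J) K.
Proof.
apply/seteqP; split; apply: comm_subgroup_min; do ?exact: comm_subgroup_group.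
  by move=> x y; apply: comm_commE_congGL.
move=> x y Qx Ky; apply: mem_comm_subgroup; last exact: relE_congGL.
exact: relE_symm_prod_sub.
Qed.

Lemma comm_commE_relE_eq I J K :
  comm_subgroup (commE I J) (relE K) = commE (symm_prod I J) K.
Proof.
apply/seteqP; split; apply: comm_subgroup_min; do ?exact: comm_subgroup_group.
  by move=> x y; apply: (comm_commE_relE hn phiC A_qf).
by move=> x y Qx Ky; apply: mem_comm_subgroup => //; apply: relE_symm_prod_sub.
Qed.

Lemma multi_comm_congGL I Ks : multi_comm (relE I) (map congGL Ks) =
  multi_comm (relE I) (map relE Ks).
Proof.
case: Ks => [//|J Ks]; rewrite /multi_comm /= comm_relE_congGL_eq.
(* The form [commE I J] is stable: one more commutator, of either kind, replaces the pair [I], [J]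
   by [symm_prod I J], [K]. *)
rewrite -/(commE I J); elim: Ks I J => [//|K Ks IH] I J /=.
by rewrite comm_commE_congGL_eq comm_commE_relE_eq.
Qed.

End MultipleCommutators.

End CongruenceCommutators.

Theorem corollary15 (n : nat) (hn : 3 <= n)
  (R : comPzRingType) (A : pzRingType) (phi : {rmorphism R -> A})
  (phi_central : central_morphism phi) (A_qf : quasi_finite phi)
  (m : nat) (I : 'I_m.+1 -> ideal A) :
  multi_comm (relE n (I ord0))
    [seq congGL n (I (lift ord0 k)) | k <- enum 'I_m]
  = multi_comm (relE n (I ord0))
    [seq relE n (I (lift ord0 k)) | k <- enum 'I_m].
Proof.
have := CongruenceCommutators.multi_comm_congGL hn phi_central A_qf (I ord0)
  [seq I (lift ord0 k) | k <- enum 'I_m].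
by rewrite -!map_comp.
Qed.
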